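(* Let $n\ge 1$ and let $\sigma$ be a function assigning a sign in $\{-,+\}$ to every triple $(i,j,k)$ of integers with $1\le i<j<k\le n$. Then $\sigma$ can be realized by a semisimple $x$-monotone drawing of $K_n$ if and only if every $4$-tuple $a<b<c<d$ of indices from $[n]$ is of one of the forms \[ {+}{+}{+}{+},\ {-}{-}{-}{-},\ {+}{+}{-}{-},\ {-}{-}{+}{+},\ {-}{+}{+}{-},\ {+}{-}{-}{+},\ {-}{-}{-}{+},\ {+}{+}{+}{-},\ {+}{-}{-}{-},\ {-}{+}{+}{+}\] in $\sigma$. Moreover, $\sigma$ can be realized by a simple $x$-monotone drawing of $K_n$ if, in addition, there is no $5$-tuple $a<b<c<d<e$ in $[n]$ such that $\sigma(a,b,e)=\sigma(a,d,e)=\sigma(b,c,d)=\overline{\sigma(a,c,e)}$.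
   Context: Drawings as usual; $x$-monotone: each edge meets every vertical line at most once and no two vertices share an $x$-coordinate. Semisimple: adjacent edges do not cross. Simple: adjacent edges do not cross and any two edges cross at most once. Given an $x$-monotone drawing of $K_n$ with vertices $v_1,\dots,v_n$ labelled so that $x(v_1)<\dots<x(v_n)$, its signature function is defined for $i<j<k$ by $\sigma(i,j,k)=-$ if $v_j$ lies above the arc representing the edge $v_iv_k$ and $\sigma(i,j,k)=+$ otherwise; $\sigma$ is realized by a drawing if it is the signature function of that drawing. For $a<b<c<d$, the $4$-tuple $(a,b,c,d)$ is of the form $\xi_1\xi_2\xi_3\xi_4$ in $\sigma$ if $\sigma(a,b,c)=\xi_1$, $\sigma(a,b,d)=\xi_2$, $\sigma(a,c,d)=\xi_3$, $\sigma(b,c,d)=\xi_4$. For a sign $\xi$, $\overline{\xi}$ denotes the opposite sign. *)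

(* Defs.v *)
From HB Require Import structures.
From mathcomp Require Import all_boot all_order all_algebra.
From mathcomp Require Import all_classical all_reals all_analysis.

Set Implicit Arguments.
Unset Strict Implicit.
Unset Printing Implicit Defensive.

Import Order.TTheory GRing.Theory Num.Theory.
Import numFieldNormedType.Exports.
Local Open Scope classical_set_scope.
Local Open Scope ring_scope.

Definition is_arc (R : realType) (A : set (R * R)) (p q : R * R) : Prop :=
  exists g : R -> R * R,
    [/\ {within [set t : R | 0 <= t <= 1], continuous g},
        set_inj [set t : R | 0 <= t <= 1] g,
        g 0 = p, g 1 = q & A = g @` [set t : R | 0 <= t <= 1]].

(* The curves A and B properly cross at p: some homeomorphism h (with inverse k)
   from an open neighbourhood U of p onto an open neighbourhood V of the origin
   takes p to the origin, A to the horizontal axis and B to the vertical one. *)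
Definition properly_cross_at (R : realType) (A B : set (R * R)) (p : R * R) :
    Prop :=
  exists (U V : set (R * R)) (h k : R * R -> R * R),
    [/\ open U, open V, U p & h p = (0, 0)] /\
    [/\ {within U, continuous h}, {within V, continuous k},
        forall z, U z -> V (h z) /\ k (h z) = z &
        forall w, V w -> U (k w) /\ h (k w) = w] /\
    (forall z, U z -> (A z <-> (h z).2 = 0) /\ (B z <-> (h z).1 = 0)).

(* The vertices of K_n are the elements of 'I_n; the edge joining i and j is
   represented by the pair whose first component is the smaller index. *)
Definition is_edge (n : nat) (e : 'I_n * 'I_n) : bool := (e.1 < e.2)%N.

Definition incident (n : nat) (i : 'I_n) (e : 'I_n * 'I_n) : bool :=
  (i == e.1) || (i == e.2).

Definition adjacent (n : nat) (e f : 'I_n * 'I_n) : bool :=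
  (e != f) && [exists i, incident i e && incident i f].

(* The values of arc on pairs that are not edges are irrelevant. *)
Record pre_drawing (R : realType) (n : nat) := PreDrawing {
  vertex : 'I_n -> R * R;
  arc : 'I_n * 'I_n -> set (R * R)
}.

Section Drawings.
Variables (R : realType) (n : nat).
Implicit Types (D : pre_drawing R n) (e f g : 'I_n * 'I_n) (p q : R * R).

Definition edge_interior D e : set (R * R) :=
  [set p | [/\ arc D e p, p <> vertex D e.1 & p <> vertex D e.2]].

Definition crossing D e f p : Prop :=
  [/\ edge_interior D e p, edge_interior D f p &
      properly_cross_at (arc D e) (arc D f) p].

(* In order: vertices are distinct points, edges are arcs joining their
   endvertices, no edge passes through another vertex, two edges share finitely
   many points, no two edges touch at an interior point, and no three edges
   share an interior point. *)
Definition is_drawing D : Prop :=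
  [/\ injective (vertex D),
      forall e, is_edge e -> is_arc (arc D e) (vertex D e.1) (vertex D e.2) &
      forall e i, is_edge e -> arc D e (vertex D i) -> incident i e] /\
  [/\ forall e f, is_edge e -> is_edge f -> e != f ->
        finite_set (arc D e `&` arc D f),
      forall e f p, is_edge e -> is_edge f -> e != f ->
        edge_interior D e p -> edge_interior D f p -> crossing D e f p &
      forall e f g p, is_edge e -> is_edge f -> is_edge g ->
        e != f -> e != g -> f != g ->
        ~ [/\ edge_interior D e p, edge_interior D f p & edge_interior D g p]].

Definition x_monotone D : Prop :=
  (forall i j, (vertex D i).1 = (vertex D j).1 -> i = j) /\
  (forall e, is_edge e ->
     forall p q, arc D e p -> arc D e q -> p.1 = q.1 -> p = q).

Definition labelled_left_to_right D : Prop :=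
  forall i j : 'I_n, (i < j)%N -> (vertex D i).1 < (vertex D j).1.

Definition semisimple D : Prop :=
  forall e f, is_edge e -> is_edge f -> adjacent e f ->
    forall p, ~ crossing D e f p.

Definition simple D : Prop :=
  semisimple D /\
  forall e f, is_edge e -> is_edge f -> e != f ->
    forall p q, crossing D e f p -> crossing D e f q -> p = q.

Definition above D (j : 'I_n) e : Prop :=
  exists y : R, arc D e ((vertex D j).1, y) /\ y < (vertex D j).2.

End Drawings.

Definition sign : Type := bool.
Definition Plus : sign := true.
Definition Minus : sign := false.
Definition opposite (s : sign) : sign := ~~ s.

(* Only the values at triples i < j < k are meaningful. *)
Definition sign_function (n : nat) : Type := 'I_n -> 'I_n -> 'I_n -> sign.

Definition signature (R : realType) (n : nat) (D : pre_drawing R n) :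
    sign_function n :=
  fun i j k => if `[< above D j (i, k) >] then Minus else Plus.

Definition realizes (R : realType) (n : nat) (D : pre_drawing R n)
    (sigma : sign_function n) : Prop :=
  forall i j k : 'I_n, (i < j)%N -> (j < k)%N ->
    sigma i j k = signature D i j k.

Definition realized_by_semisimple (R : realType) (n : nat)
    (sigma : sign_function n) : Prop :=
  exists D : pre_drawing R n,
    [/\ is_drawing D, x_monotone D, labelled_left_to_right D, semisimple D &
        realizes D sigma].

Definition realized_by_simple (R : realType) (n : nat)
    (sigma : sign_function n) : Prop :=
  exists D : pre_drawing R n,
    [/\ is_drawing D, x_monotone D, labelled_left_to_right D, simple D &
        realizes D sigma].

Definition has_form (n : nat) (sigma : sign_function n) (a b c d : 'I_n)
    (xi : sign * sign * sign * sign) : Prop :=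
  (sigma a b c, sigma a b d, sigma a c d, sigma b c d) = xi.

Definition allowed_forms : seq (sign * sign * sign * sign) :=
  [:: (Plus, Plus, Plus, Plus);     (Minus, Minus, Minus, Minus);
      (Plus, Plus, Minus, Minus);   (Minus, Minus, Plus, Plus);
      (Minus, Plus, Plus, Minus);   (Plus, Minus, Minus, Plus);
      (Minus, Minus, Minus, Plus);  (Plus, Plus, Plus, Minus);
      (Plus, Minus, Minus, Minus);  (Minus, Plus, Plus, Plus)].

Definition four_tuple_condition (n : nat) (sigma : sign_function n) : Prop :=
  forall a b c d : 'I_n, (a < b)%N -> (b < c)%N -> (c < d)%N ->
    exists2 xi, xi \in allowed_forms & has_form sigma a b c d xi.

Definition forbidden_five_tuple (n : nat) (sigma : sign_function n)
    (a b c d e : 'I_n) : Prop :=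
  [/\ sigma a b e = sigma a d e, sigma a d e = sigma b c d &
      sigma b c d = opposite (sigma a c e)].

(* Main.v *)
Require Import Defs.
From HB Require Import structures.
From mathcomp Require Import all_boot all_order all_algebra.
From mathcomp Require Import all_classical all_reals all_analysis.
From mathcomp Require Import zify lra ring.

Set Implicit Arguments.
Unset Strict Implicit.
Unset Printing Implicit Defensive.

(* [Defs] is imported again because [path.arc] shadows [Defs.arc]. *)
Import Defs Order.TTheory GRing.Theory Num.Theory.
Import numFieldNormedType.Exports.
Local Open Scope ring_scope.

(* The forbidden 4-tuples are those for which the edges leaving the first
   vertex to the right, or those entering the last vertex from the left, would
   be cyclically ordered in height; two adjacent edges would then change their
   order between two vertical lines and hence cross.

   Conversely, put the vertices at (0,0), (1,0), ..., (n-1,0).  On the vertical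
   line through a vertex, an edge lies above or below that vertex as prescribed
   by sigma; among edges on the same side the order of the previous line is
   kept, and edges with the same left end start in the order that sigma
   prescribes.  Joining consecutive lines by segments, two edges cross only
   where sigma forces their order to change, and this never happens for
   adjacent edges.  If two edges cross twice, vertices p < q < r separate them
   in alternating ways, and whichever side of the edge pr contains q, that edge
   and one of the two edges yield a forbidden 5-tuple.  Small perturbations of
   the heights remove triple points. *)

(** * Combinatorial order of the edges along each vertical line *)

Section Levels.
Variables (R : realType) (n : nat) (tau : nat -> nat -> nat -> bool).
Implicit Types e f : 'I_n * 'I_n.

(** [tauL] and [tauR] together encode the ten allowed forms: each rules out four sign patterns, two
    of which are common to both. [tauL] governs edges with a common left end, [tauR] those with a
    common right end. *)
Hypothesis tauL : forall a b c d, (a < b)%N -> (b < c)%N -> (c < d)%N ->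
  (d < n)%N -> tau a b c = tau a c d -> tau a b d = tau a b c.
Hypothesis tauR : forall a b c d, (a < b)%N -> (b < c)%N -> (c < d)%N ->
  (d < n)%N -> tau a b d = tau b c d -> tau a c d = tau a b d.

(** Position of [e] relative to the vertex [m]: 1 above it, -1 below it, 0 at an end of [e] or
    outside its range. The value [true] is Plus, where the vertex is not above the edge. *)
Definition side (m : nat) e : R :=
  if (e.1 < m < e.2)%N then if tau e.1 m e.2 then 1 else -1 else 0.

(** The order in which [ab] and [ac] should leave [a]: the right end of the shorter edge lies on one
    side of the longer edge, and that side decides. *)
Definition starts_below (a b c : nat) : bool :=
  if (b < c)%N then tau a b c else (c < b)%N && ~~ tau a c b.

Lemma starts_below_total a b c :
  b != c -> starts_below a b c || starts_below a c b.
Proof. by rewrite /starts_below; case: ltngtP => //=; case: (tau _ _ _). Qed.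

(** A cyclic order among three right ends x < y < z would make the signs of axy and ayz equal and
    that of axz opposite, against [tauL]. The cases are the relative positions of the three right
    ends. *)
Lemma starts_below_trans a b c d : (a < b)%N -> (a < c)%N -> (a < d)%N ->
  (b < n)%N -> (c < n)%N -> (d < n)%N ->
  starts_below a b c -> starts_below a c d -> starts_below a b d.
Proof.
rewrite /starts_below => ab ac ad bn cn dn.
have L x y z : (a < x)%N -> (x < y)%N -> (y < z)%N -> (z < n)%N ->
    tau a x y = tau a y z -> tau a x z = tau a x y by move=> *; apply: tauL.
case: (ltngtP b c) => // bc; case: (ltngtP c d) => // cd;
  case: (ltngtP b d) => bd //=; try lia.
- by have := L _ _ _ ab bc cd dn; do 3![case: (tau a _ _)] => // ->.
- by have := L _ _ _ ab bd cd cn; do 3![case: (tau a _ _)] => // ->.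
- by have := L _ _ _ ad bd bc cn; do 3![case: (tau a _ _)] => // ->.
- by rewrite bd => ->.
- by have := L _ _ _ ac bc bd dn; do 3![case: (tau a _ _)] => // ->.
- by have := L _ _ _ ac cd bd bn; do 3![case: (tau a _ _)] => // ->.
- by rewrite bd => /negbTE ->.
- by have := L _ _ _ ad cd bc bn; do 3![case: (tau a _ _)] => // ->.
Qed.

(** Turns the start order at the left end of [e] into a number. *)
Definition start_rank e : nat :=
  #|[set x : 'I_n | (e.1 < x)%N && starts_below e.1 x e.2]|.

Lemma start_rank_lt e f : is_edge e -> is_edge f -> e.1 = f.1 ->
  starts_below e.1 e.2 f.2 -> (start_rank e < start_rank f)%N.
Proof.
move=> ee ef e1 eb; apply: proper_card; apply/properP; split.
  apply/fintype.subsetP => x; rewrite !inE -e1 => /andP[ex xb]; rewrite ex /=.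
  apply: (starts_below_trans (c := e.2)) => //; rewrite e1; exact: ef.
exists e.2; rewrite !inE -?e1 ?eb ?andbT; first exact: ee.
by rewrite /starts_below ltnn andbF.
Qed.

(** Scaled below 1/2, so that the start order never outweighs a difference of sides. *)
Definition tie e : R := (start_rank e)%:R / (n.+1)%:R / 2.

Lemma tie_bounds e : 0 <= tie e < 1 / 2.
Proof.
have rn : (start_rank e < n.+1)%N.
  by rewrite ltnS /start_rank (leq_trans (max_card _)) ?card_ord.
have h0 : 0 <= (start_rank e)%:R / (n.+1)%:R :> R by rewrite divr_ge0.
have h1 : (start_rank e)%:R / (n.+1)%:R < 1 :> R.
  by rewrite ltr_pdivrMr ?ltr0n // mul1r ltr_nat.
by rewrite /tie; move: (_ / n.+1%:R) h0 h1 => q *; apply/andP; split; lra.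
Qed.

(* The height order of the edges on the vertical line through vertex [m]: the
   position relative to the vertex decides, and otherwise the order on the
   previous line is kept. *)
Fixpoint level (m : nat) e : R :=
  if m is m'.+1 then
    if (m <= e.1)%N then tie e else side m e + level m' e / 4
  else tie e.

Lemma level_start m e : (m <= e.1)%N -> level m e = tie e.
Proof. by case: m => //= m ->. Qed.

Lemma levelS m e : (e.1 <= m)%N -> level m.+1 e = side m.+1 e + level m e / 4.
Proof. by move=> h /=; rewrite ltnNge h. Qed.

Lemma side_bounds m e : -1 <= side m e <= 1.
Proof. by rewrite /side; do ?case: ifP => _; apply/andP; split; lra. Qed.

Lemma level_bounds m e : - (3 / 2) < level m e < 3 / 2.
Proof.
elim: m => [|m IH] /=; first by have /andP[] := tie_bounds e; lra.
have /andP[? ?] := tie_bounds e; have /andP[? ?] := side_bounds m.+1 e.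
by case/andP: IH => ? ?; case: ifP => _; apply/andP; split; lra.
Qed.

(** The previous level is smaller than 3/2 in absolute value, so after division by 4 it contributes
    less than 3/8. Sides are integers and therefore dominate the order. *)
Lemma level_near m e : (e.1 <= m)%N ->
  side m e - 1 / 2 < level m e < side m e + 1 / 2.
Proof.
rewrite leq_eqVlt => /orP[/eqP em|].
  rewrite level_start -?em // /side ltnn /=.
  by have /andP[? ?] := tie_bounds e; apply/andP; split; lra.
case: m => // m; rewrite ltnS => em; rewrite levelS //.
by have /andP[? ?] := level_bounds m e; apply/andP; split; lra.
Qed.

Lemma side_gap m e f : side m e < side m f -> side m e + 1 <= side m f.
Proof.
by rewrite /side; do ?case: ifP => _; lra.
Qed.

Lemma level_sep m e f : (e.1 <= m)%N -> (f.1 <= m)%N ->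
  side m e < side m f -> level m e < level m f.
Proof.
move=> em fm /side_gap; have /andP[_ ?] := level_near em.
by have /andP[? _] := level_near fm; lra.
Qed.

Lemma level_lt_side m e f : (e.1 <= m)%N -> (f.1 <= m)%N ->
  level m e < level m f -> side m e <= side m f.
Proof.
move=> em fm h; rewrite leNgt; apply/negP => /(level_sep fm em).
by rewrite ltNge ltW.
Qed.

Lemma level_keep m e f : (e.1 <= m)%N -> (f.1 <= m)%N ->
  side m.+1 e = side m.+1 f ->
  (level m.+1 e < level m.+1 f) = (level m e < level m f).
Proof. by move=> em fm s; rewrite !levelS // s; apply/idP/idP; lra. Qed.

(** In contrapositive form: a reversal between consecutive lines requires strictly opposed sides on
    the second line. *)
Lemma level_next m e f : (e.1 <= m)%N -> (f.1 <= m)%N ->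
  side m.+1 e <= side m.+1 f -> level m e < level m f ->
  level m.+1 e < level m.+1 f.
Proof.
move=> em fm; rewrite le_eqVlt => /orP[/eqP s|s _]; first by rewrite level_keep.
by apply: level_sep => //; exact: leqW.
Qed.

(** At a vertex strictly inside both edges, [tauL] applied to the common left end, [m] and the two
    right ends excludes that [e] passes above and [f] below. At the earlier right end the side of
    the longer edge is the start order itself. *)
Lemma side_left m e f : is_edge e -> is_edge f -> e.1 = f.1 ->
  starts_below e.1 e.2 f.2 -> (e.1 < m)%N -> (m <= e.2)%N -> (m <= f.2)%N ->
  side m e <= side m f.
Proof.
move=> ee ef ef1; rewrite /side /starts_below -ef1 => sb em.
rewrite em /= [(m <= e.2)%N]leq_eqVlt [(m <= f.2)%N]leq_eqVlt.
case/predU1P => [me|me]; case/predU1P => [mf|mf].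
- by rewrite -me -mf !ltnn.
- by move: sb; rewrite -me ltnn mf => ->; lra.
- move: sb; rewrite -mf ltnn me [(e.2 < m)%N]ltnNge (ltnW me) /=.
  by move=> /negbTE ->; lra.
rewrite me mf; case: (ltngtP e.2 f.2) sb => // h sb.
  have := tauL em me h (ltn_ord _); rewrite sb; case: (tau _ m _) => // h1.
    by rewrite h1 //; lra.
  by case: (tau _ m _); lra.
have := tauL em mf h (ltn_ord _); rewrite (negbTE sb); case: (tau _ m f.2) => // h1.
  by case: (tau _ m _); lra.
by rewrite h1 //; lra.
Qed.

Lemma level_left m e f : is_edge e -> is_edge f -> e.1 = f.1 ->
  starts_below e.1 e.2 f.2 -> (e.1 <= m)%N -> (m <= e.2)%N -> (m <= f.2)%N ->
  level m e < level m f.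
Proof.
move=> ee ef ef1 sb em; elim: m em => [|m IH] em me mf.
  rewrite /= /tie ltr_pM2r ?ltr_pM2r ?invr_gt0 ?ltr0n // ltr_nat.
  exact: start_rank_lt.
move: em; rewrite leq_eqVlt => /predU1P[em|em].
  rewrite !level_start -?ef1 ?em // /tie.
  rewrite ltr_pM2r ?ltr_pM2r ?invr_gt0 ?ltr0n // ltr_nat.
  exact: start_rank_lt.
apply: level_next; rewrite -?ef1 //; first exact: side_left.
by apply: IH => //; exact: ltnW.
Qed.

(** The mirror case: the order is set at the later left end, where [f] passes above or below the
    start of [e], and [tauR] prevents any later vertex from opposing it. *)
Lemma side_right m e f : is_edge e -> is_edge f -> e.2 = f.2 ->
  (f.1 < e.1)%N -> (e.1 <= m)%N ->
  if tau f.1 e.1 e.2 then side m e <= side m f else side m f <= side m e.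
Proof.
move=> ee ef ef2 fe; rewrite /side -ef2.
case: (ltnP m e.2) => me; last by rewrite !andbF; case: ifP.
rewrite leq_eqVlt => /predU1P[em|em].
  by rewrite -em ltnn fe /=; case: (tau _ _ _); lra.
rewrite em (ltn_trans fe em) /=.
have := tauR fe em me (ltn_ord _).
case: (tau f.1 e.1 e.2); case: (tau e.1 m e.2) => [] h.
- by rewrite h.
- by case: (tau _ _ _); lra.
- by case: (tau _ _ _); lra.
by rewrite h.
Qed.

Lemma level_right m e f : is_edge e -> is_edge f -> e.2 = f.2 ->
  (f.1 < e.1)%N -> (e.1 <= m)%N ->
  if tau f.1 e.1 e.2 then level m e < level m f else level m f < level m e.
Proof.
move=> ee ef ef2 fe; elim: m => [|m IH] em; first by move: fe em; lia.
move: em; rewrite leq_eqVlt => /predU1P[em|em].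
  have em' : (e.1 <= m.+1)%N by rewrite em.
  have fm' : (f.1 <= m.+1)%N by rewrite -em ltnW.
  have ef' : (e.1 < e.2)%N by [].
  case h: (tau _ _ _); apply: level_sep => //;
    rewrite /side -ef2 -em ltnn fe ef' h /=; lra.
have fm : (f.1 <= m)%N by rewrite ltnW // (leq_trans fe).
have := side_right ee ef ef2 fe (ltnW em); have := IH em.
by case: (tau _ _ _) => h1 h2; apply: level_next.
Qed.

Lemma adjacent_keep m e f : is_edge e -> is_edge f -> e != f ->
  e.1 = f.1 \/ e.2 = f.2 -> (e.1 <= m)%N -> (f.1 <= m)%N ->
  (m < e.2)%N -> (m < f.2)%N -> level m e < level m f ->
  level m.+1 e < level m.+1 f.
Proof.
move=> ee ef nef [ef1|ef2] em fm me mf lt_m.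
  have ne2 : e.2 != f.2 :> nat.
    apply: contraNneq nef => /val_inj; move: (ef1).
    by case: (e) => ? ?; case: (f) => ? ? /= -> ->.
  have em' := leqW em.
  case/orP: (starts_below_total e.1 ne2) => sb; first exact: level_left.
  suff : level m f < level m e by rewrite ltNge ltW.
  apply: level_left => //; [by rewrite -ef1|exact: ltnW|exact: ltnW].
have ne1 : e.1 != f.1 :> nat.
  apply: contraNneq nef => /val_inj; move: (ef2).
  by case: (e) => ? ?; case: (f) => ? ? /= -> ->.
case: (ltngtP e.1 f.1) ne1 => // h _.
  have := level_right ef ee (esym ef2) h fm.
  have := level_right ef ee (esym ef2) h (leqW fm).
  by case: (tau _ _ _) => // _; rewrite ltNge (ltW lt_m).
have := level_right ee ef ef2 h em.
have := level_right ee ef ef2 h (leqW em).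
by case: (tau _ _ _) => // _; rewrite ltNge (ltW lt_m).
Qed.

Lemma side_start e f : (e.1 < f.1)%N -> (f.1 < e.2)%N ->
  side f.1 e != side f.1 f.
Proof.
move=> ef fe; rewrite /side ef fe ltnn /=; case: (tau _ _ _).
  by rewrite oner_neq0.
by rewrite oppr_eq0 oner_neq0.
Qed.

(** At the start of [f] the sides are 0 and 1 or -1. On later lines either the sides differ again or
    the difference of levels is only divided by 4. *)
Lemma level_apart m e f : (e.1 < f.1)%N -> (f.1 < e.2)%N -> (f.1 <= m)%N ->
  level m e != level m f.
Proof.
move=> ef fe fm; have em := leq_trans (ltnW ef) fm.
have sep k : (f.1 <= k)%N -> side k e != side k f -> level k e != level k f.
  move=> fk; have ek := leq_trans (ltnW ef) fk.
  by rewrite neq_lt => /orP[] /level_sep h; rewrite neq_lt h ?orbT.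
elim: m fm em => [|m IH] fm em.
  by apply: sep => //; move: ef fm; lia.
move: fm; rewrite leq_eqVlt => /predU1P[fm|fm].
  by rewrite -fm; apply: sep; rewrite ?leqnn //; exact: side_start.
have [sm|/sep] := eqVneq (side m.+1 e) (side m.+1 f); last by apply; exact: ltnW.
have em' : (e.1 <= m)%N by lia.
by have := IH fm em'; rewrite !neq_lt !level_keep.
Qed.

(** Equal sides keep the order, so the order on line [m] goes back to the latest line where the
    sides differ. The search ends at the latest at the later of the two left ends, where exactly one
    side is 0. *)
Lemma last_separation m e f : (e.1 < f.1)%N || (f.1 < e.1)%N ->
  (f.1 < e.2)%N -> (e.1 < f.2)%N -> (e.1 <= m)%N -> (f.1 <= m)%N ->
  level m e < level m f ->
  exists p, [/\ (e.1 <= p)%N, (f.1 <= p <= m)%N, side p e < side p f &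
    forall q, (p < q <= m)%N -> side q e = side q f].
Proof.
move=> ne fe ef em fm.
have here k : (e.1 <= k)%N -> (f.1 <= k)%N -> level k e < level k f ->
    side k e != side k f ->
    exists p, [/\ (e.1 <= p)%N, (f.1 <= p <= k)%N, side p e < side p f &
      forall q, (p < q <= k)%N -> side q e = side q f].
  move=> ek fk /(level_lt_side ek fk) h1 h2; exists k; rewrite ek fk leqnn.
  by split=> //; [rewrite lt_neqAle h2|move=> q; lia].
have start k : k = e.1 :> nat \/ k = f.1 :> nat -> (e.1 <= k)%N ->
    (f.1 <= k)%N -> side k e != side k f.
  move=> [] -> h1 h2; last by apply: side_start => //; lia.
  by rewrite eq_sym; apply: side_start => //; lia.
elim: m em fm => [|m IH] em fm lt_m.
  by apply: here => //; apply: start => //; left; lia.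
have [sm|] := eqVneq (side m.+1 e) (side m.+1 f); last exact: here.
have [em'|em'] := leqP e.1 m; last first.
  by apply: here => //; apply: start => //; left; lia.
have [fm'|fm'] := leqP f.1 m; last first.
  by apply: here => //; apply: start => //; right; lia.
move: lt_m; rewrite level_keep // => /(IH em' fm')[p [ep /andP[fp pm] sp eqp]].
exists p; split=> //; first by rewrite fp leqW.
move=> q /andP[pq]; rewrite leq_eqVlt ltnS => /predU1P[-> //|qm].
by apply: eqp; rewrite pq.
Qed.

Hypothesis no_forbidden : forall a b c d z, (a < b)%N -> (b < c)%N ->
  (c < d)%N -> (d < z)%N -> (z < n)%N ->
  ~ [/\ tau a b z = tau a d z, tau a d z = tau b c d &
        tau b c d = ~~ tau a c z].

(** If [e] is on side [s] of [q] but not of [p] or [r], the chord from [p] to [r] must follow it at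
    [q]. With both ends shared the chord is [e]; with one shared end the 4-tuple conditions decide;
    with none, failure is a forbidden 5-tuple. *)
Lemma chord_side e p q r (s : bool) : (p < q)%N -> (q < r)%N ->
  p = e.1 \/ (e.1 < p)%N /\ tau e.1 p e.2 = ~~ s ->
  r = e.2 \/ (r < e.2)%N /\ tau e.1 r e.2 = ~~ s ->
  tau e.1 q e.2 = s -> tau p q r = s.
Proof.
move=> pq qr hp hr hq; apply/eqP; case: eqVneq => // /eqP hs.
have {}hs : tau p q r = ~~ s by case: (tau p q r) s {hp hr hq} hs => -[].
have e2n := ltn_ord e.2.
case: hp hr => [pe|[pe sp]] [re|[re sr]].
- by move: hs; rewrite pe re hq; case: (s).
- rewrite pe in pq hs; have := tauL pq qr re e2n.
  by rewrite hs sr hq => /(_ erefl); case: (s).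
- rewrite re in qr hs; have := tauR pe pq qr e2n.
  by rewrite sp hs hq => /(_ erefl); case: (s).
case: (no_forbidden pe pq qr re e2n); rewrite sp sr hs hq.
by split=> //; rewrite negbK.
Qed.

Lemma side_lower m e f : (e.1 <= m <= e.2)%N -> side m e < side m f ->
  [\/ m = e.1, m = e.2 | (e.1 < m < e.2)%N /\ tau e.1 m e.2 = false].
Proof.
move=> em; rewrite {1}/side; case: ifP => h; last first.
  have [->|->] : m = e.1 \/ m = e.2 by lia.
    by constructor 1.
  by constructor 2.
case: ifP => [_|? _]; last by constructor 3.
by have /andP[_ ?] := side_bounds m f; lra.
Qed.

Lemma side_upper m e f : (e.1 <= m <= e.2)%N -> side m f < side m e ->
  [\/ m = e.1, m = e.2 | (e.1 < m < e.2)%N /\ tau e.1 m e.2 = true].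
Proof.
move=> em; rewrite {2}/side; case: ifP => h; last first.
  have [->|->] : m = e.1 \/ m = e.2 by lia.
    by constructor 1.
  by constructor 2.
case: ifP => [? _|_]; first by constructor 3.
by have /andP[? _] := side_bounds m f; lra.
Qed.

(* Whichever side of the edge from [p] to [r] the vertex [q] lies on, that edge
   together with [e] or with [f] violates [chord_side]. *)
Lemma no_three_separations e f p q r : (e.1 <= p)%N -> (f.1 <= p)%N ->
  (p < q)%N -> (q < r)%N -> (r <= e.2)%N -> (r <= f.2)%N ->
  side p e < side p f -> side q f < side q e -> side r e < side r f -> False.
Proof.
move=> ep fp pq qr re rf sp sq sr.
have [hpe hpf] : (e.1 <= p <= e.2)%N /\ (f.1 <= p <= f.2)%N by lia.
have [hqe hqf] : (e.1 <= q <= e.2)%N /\ (f.1 <= q <= f.2)%N by lia.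
have [hre hrf] : (e.1 <= r <= e.2)%N /\ (f.1 <= r <= f.2)%N by lia.
have tpf : tau p q r = true.
  apply: (@chord_side e) => //.
  - by case: (side_lower hpe sp) => [||[/andP[]]]; [left|lia|right].
  - by case: (side_lower hre sr) => [||[/andP[]]]; [lia|left|right].
  by case: (side_upper hqe sq) => [||[]]; lia.
have : tau p q r = false; last by rewrite tpf.
apply: (@chord_side f) => //.
- by case: (side_upper hpf sp) => [||[/andP[]]]; [left|lia|right].
- by case: (side_upper hrf sr) => [||[/andP[]]]; [lia|left|right].
by case: (side_lower hqf sq) => [||[]]; lia.
Qed.

(** A reversal that is undone later gives three separations in alternating directions: one up to
    [m], one at [m.+1], and one after it. *)
Lemma reversal_unique m k e f : (e.1 < f.1)%N || (f.1 < e.1)%N ->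
  (e.1 <= m)%N -> (f.1 <= m)%N -> (m.+1 < k)%N -> (k <= e.2)%N ->
  (k <= f.2)%N -> level m e < level m f -> level m.+1 f < level m.+1 e ->
  level k e < level k f -> False.
Proof.
move=> ne em fm mk ke kf l0 l1 l2.
have fe : (f.1 < e.2)%N by lia.
have ef : (e.1 < f.2)%N by lia.
have sm : side m.+1 f < side m.+1 e.
  rewrite ltNge; apply/negP => /(level_next em fm)/(_ l0).
  by rewrite ltNge ltW.
have [p [ep /andP[fp pm] sp _]] := last_separation ne fe ef em fm l0.
have ek : (e.1 <= k)%N by lia.
have fk : (f.1 <= k)%N by lia.
have [r [er /andP[fr rk] sr eqr]] := last_separation ne fe ef ek fk l2.
(* The last separation [r] before line [k] has the direction opposite to that at [m.+1], and the
   sides agree after [r]; so [r] can be neither [m.+1] nor earlier. *)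
have mr : (m.+1 < r)%N.
  rewrite ltnNge leq_eqVlt; apply/negP => /predU1P[rm|rm].
    by move: sr; rewrite rm ltNge ltW.
  by move: sm; rewrite (eqr m.+1) ?ltxx // rm /= ltnW.
by apply: (@no_three_separations e f p m.+1 r) => //; lia.
Qed.

End Levels.

(** * Generic choices of real numbers *)

Lemma avoid_finite (R : realFieldType) (s : seq R) (a b : R) : a < b ->
  exists x, a < x < b /\ x \notin s.
Proof.
elim: s a b => [|z s IH] a b ab.
  by exists ((a + b) / 2); rewrite in_nil; split=> //; apply/andP; split; lra.
have [zab|zab] := leP z ((a + b) / 2).
  have [|x [/andP[x1 x2] xs]] := IH ((a + b) / 2) b; first by lra.
  exists x; rewrite in_cons negb_or xs andbT; split.
    by apply/andP; split; lra.
  by apply/eqP; lra.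
have [|x [/andP[x1 x2] xs]] := IH a ((a + b) / 2); first by lra.
exists x; rewrite in_cons negb_or xs andbT; split.
  by apply/andP; split; lra.
by apply/eqP; lra.
Qed.

(* Greedy choice of a generic sequence near [y]: the forbidden values of the
   [k]-th term are computed from the earlier terms only. *)
Lemma generic_sequence (R : realType) (y : nat -> R) (d : R)
    (bad : (nat -> R) -> seq R) : 0 < d ->
  exists h : nat -> R, forall k, y k - d < h k < y k + d /\
    h k \notin bad (fun j => if (j < k)%N then h j else 0).
Proof.
move=> d0.
have /choice[pk hpk] (kg : nat * (nat -> R)) : exists x,
    y kg.1 - d < x < y kg.1 + d /\ x \notin bad kg.2.
  by apply: avoid_finite; lra.
(* [fn k] is the table of the first [k] choices, with 0 elsewhere; the sequence sought is its
   diagonal, which agrees with [fn k] below [k]. *)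
pose fn := nat_rect (fun=> nat -> R) (fun=> 0)
  (fun k g j => if j == k then pk (k, g) else g j).
exists (fun k => fn k.+1 k) => k.
suff -> : (fun j => if (j < k)%N then fn j.+1 j else 0) = fn k.
  by rewrite /= eqxx; exact: (hpk (k, fn k)).
have fnS i j : fn i.+1 j = if j == i then pk (i, fn i) else fn i j by [].
apply/funext; elim: k => [//|k IH] j; rewrite ltnS leq_eqVlt [RHS]fnS -IH.
by have [->|] := eqVneq j k; rewrite // fnS eqxx.
Qed.

Lemma positive_gap (R : realType) (T : finType) (g : T -> R) :
  exists2 d : R, 0 < d & forall t, 0 < g t -> d <= g t.
Proof.
exists (\big[Num.min/1]_(t | 0 < g t) g t).
  by apply: lt_bigmin.
by move=> t gt; exact: bigmin_le_cond.
Qed.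

(** * Perturbing the levels into heights without concurrent segments *)

Section Heights.
Variables (R : realType) (n : nat) (tau : nat -> nat -> nat -> bool).
Implicit Types (e f g : 'I_n * 'I_n).
Local Notation level := (level R tau).

Hypothesis tauL : forall a b c d, (a < b)%N -> (b < c)%N -> (c < d)%N ->
  (d < n)%N -> tau a b c = tau a c d -> tau a b d = tau a b c.

Definition ends_at (m : nat) e : bool :=
  (m == e.1 :> nat) || (m == e.2 :> nat).

Definition spans (m : nat) e : bool := (e.1 <= m <= e.2)%N.

Lemma inner_spans m e : spans m e -> (e.1 < m < e.2)%N = ~~ ends_at m e.
Proof. by rewrite /spans /ends_at; lia. Qed.

Lemma strip_spans m e : (e.1 <= m < e.2)%N -> spans m e /\ spans m.+1 e.
Proof. by rewrite /spans; lia. Qed.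

Lemma strip_ends m e : (e.1 <= m < e.2)%N ->
  ends_at m e = (e.1 == m :> nat) /\ ends_at m.+1 e = (e.2 == m.+1 :> nat).
Proof. by rewrite /ends_at; lia. Qed.

Lemma edge_eq e f : e.1 = f.1 :> nat -> e.2 = f.2 :> nat -> e = f.
Proof.
by case: e f => [a b] [c d] /= h1 h2; congr (_, _); apply: val_inj.
Qed.

Lemma level_neq m e f : is_edge e -> is_edge f -> e != f ->
  spans m e -> spans m f -> (f.1 < e.2)%N -> (e.1 < f.2)%N ->
  level m e != level m f.
Proof.
move=> ee ef nef /andP[em me] /andP[fm mf] fe fe'.
case: (ltngtP e.1 f.1) => ef1.
- exact: level_apart.
- by rewrite eq_sym; exact: level_apart.
have ef1' : e.1 = f.1 by apply: val_inj.
have ne2 : e.2 != f.2 :> nat.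
  by apply: contraNneq nef => h; apply/eqP/edge_eq.
case/orP: (starts_below_total tau e.1 ne2) => sb.
  by rewrite neq_lt (level_left _ tauL).
by rewrite neq_lt [X in _ || X](level_left _ tauL) ?orbT // -ef1'.
Qed.

(** Enumerates the pairs line by line, so that all heights on line [m] are chosen before any on line
    [m.+1]. *)
Definition code (m : nat) e : nat := (m * #|{: 'I_n * 'I_n}| + enum_rank e)%N.

Lemma code_lt m e f : (code m e < code m.+1 f)%N.
Proof.
rewrite /code mulSn addnC addnAC ltn_add2r.
by rewrite (leq_trans (ltn_ord (enum_rank e))) // leq_addr.
Qed.

Lemma code_inj m k e f : code m e = code k f -> m = k /\ e = f.
Proof.
rewrite /code => h; set N := #|_| in h.
have N0 : (0 < N)%N by apply: leq_ltn_trans (ltn_ord (enum_rank e)).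
have mk : m = k.
  have := congr1 (fun x => x %/ N)%N h; rewrite !divnMDl //.
  by rewrite !divn_small ?addn0.
split=> //; move: h; rewrite mk => /addnI/val_inj; exact: enum_rank_inj.
Qed.

(** Heights at the ends of an edge are pinned to 0, since the vertices lie on the horizontal axis;
    only the others are free to be perturbed. *)
Definition height (h : nat -> R) (m : nat) e : R :=
  if ends_at m e then 0 else h (code m e).

(** The height on line [m.+1] that would send the segment of [e] through the crossing of the
    segments of [f] and [g]. *)
Definition concurrent_value (h : nat -> R)
    (x : 'I_n * ('I_n * 'I_n) * ('I_n * 'I_n) * ('I_n * 'I_n)) : R :=
  let: (m, e, f, g) := x in
  height h m.+1 f + (height h m e - height h m f) /
    (height h m g - height h m f) * (height h m.+1 g - height h m.+1 f).

(** Free heights stay so close to the levels that order and sign survive. In a concurrency the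
    height chosen last on the right-hand line would be a concurrent value of earlier ones, which the
    greedy choice avoids. *)
Lemma heights_exist : exists H : nat -> 'I_n * 'I_n -> R,
  [/\ forall m e, ends_at m e -> H m e = 0,
      forall m e, (e.1 < m < e.2)%N -> if tau e.1 m e.2 then 0 < H m e
        else H m e < 0,
      forall m e f, is_edge e -> is_edge f -> spans m e -> spans m f ->
        ~~ (ends_at m e && ends_at m f) -> level m e < level m f ->
        H m e < H m f &
      forall m e f g (t c : R), is_edge e -> is_edge f -> is_edge g ->
        e != f -> e != g -> f != g ->
        (e.1 <= m < e.2)%N -> (f.1 <= m < f.2)%N -> (g.1 <= m < g.2)%N ->
        0 < t < 1 ->
        (1 - t) * H m e + t * H m.+1 e = c ->
        (1 - t) * H m f + t * H m.+1 f = c ->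
        (1 - t) * H m g + t * H m.+1 g = c -> False].
Proof.
have [d d0 hd] := positive_gap
  (fun x : 'I_n * ('I_n * 'I_n) * ('I_n * 'I_n) =>
     level x.1.1 x.2 - level x.1.1 x.1.2).
(* Half the smallest gap preserves the order; 1/2 preserves the sign, because a level with side 1 or
   -1 has absolute value above 1/2. *)
pose r : R := Num.min (d / 2) (1 / 2).
have r0 : 0 < r by rewrite lt_min; apply/andP; split; lra.
have rd : r <= d / 2 by rewrite ge_min lexx.
have r2 : r <= 1 / 2 by rewrite ge_min lexx orbT.
(* Decodes [k] into its line and edge; the default 0 is for numbers that code no such pair. *)
pose y k := if [pick x : 'I_n * ('I_n * 'I_n) | code x.1 x.2 == k] is Some x
  then level x.1 x.2 else 0 : R.
have [h hP] := generic_sequence y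
  (fun h => [seq concurrent_value h x | x : 'I_n * _ * _ * _]) r0.
have y_code (m : nat) e : (m < n)%N -> y (code m e) = level m e.
  move=> mn; rewrite /y; case: pickP => [x /eqP/code_inj[-> ->] //|].
  by move/(_ (Ordinal mn, e)); rewrite eqxx.
have near m e : (m < n)%N ->
    level m e - r < h (code m e) < level m e + r.
  by move=> mn; rewrite -y_code //; case: (hP (code m e)).
have sgn m e : (e.1 < m < e.2)%N -> if tau e.1 m e.2 then 0 < height h m e
    else height h m e < 0.
  move=> /andP[em me].
  have mn : (m < n)%N := ltn_trans me (ltn_ord _).
  have /andP[n1 n2] := near m e mn.
  have /andP[] := level_near R tau (ltnW em); rewrite /side em me /=.
  rewrite /height /ends_at [m == _]gtn_eqF // [m == _]ltn_eqF //=.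
  by case: (tau _ _ _) => ? ?; lra.
have mono m e f : is_edge e -> is_edge f -> spans m e -> spans m f ->
    ~~ (ends_at m e && ends_at m f) -> level m e < level m f ->
    height h m e < height h m f.
  move=> ee ef se sf nends lt_ef.
  have mn : (m < n)%N by case/andP: se => _ /leq_ltn_trans; apply.
  have /andP[em me] := se; have /andP[fm mf] := sf.
  (* A pinned height may be far from its level, so here the comparison uses the side of the other
     edge and the sign of its height. *)
  have [he|he] := boolP (ends_at m e).
    have hf : (f.1 < m < f.2)%N by rewrite inner_spans // he in nends *.
    have := level_lt_side em fm lt_ef; have := sgn _ _ hf.
    have -> : height h m e = 0 by rewrite /height he.
    rewrite /side hf inner_spans // he /=.
    by case: (tau _ _ _) => //; lra.
  have [hf|hf] := boolP (ends_at m f).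
    have he' : (e.1 < m < e.2)%N by rewrite inner_spans.
    have := level_lt_side em fm lt_ef; have := sgn _ _ he'.
    have -> : height h m f = 0 by rewrite /height hf.
    rewrite /side he' inner_spans // hf /=.
    by case: (tau _ _ _) => //; lra.
  rewrite /height (negbTE he) (negbTE hf).
  have /andP[_ ?] := near m e mn; have /andP[? _] := near m f mn.
  have := hd (Ordinal mn, e, f); rewrite /= subr_gt0 => /(_ lt_ef); lra.
exists (height h); split=> //; first by move=> m e he; rewrite /height he.
have tie_ends m e f : is_edge e -> is_edge f -> e != f ->
    spans m e -> spans m f -> (f.1 < e.2)%N -> (e.1 < f.2)%N ->
    height h m e = height h m f -> ends_at m e && ends_at m f.
  move=> ee ef nef se sf fe fe' eqh; apply/negPn/negP => nends.
  have := level_neq ee ef nef se sf fe fe'; rewrite neq_lt => /orP[] /mono.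
    by rewrite eqh ltxx => /(_ ee ef se sf nends).
  by rewrite eqh ltxx => /(_ ef ee sf se); rewrite andbC => /(_ nends).
(* Segments that meet inside the strip and agree on line [m] also agree on line [m.+1]; both edges
   then join the vertices [m] and [m.+1], so they are equal. *)
have distinct m e f (t c : R) : is_edge e -> is_edge f -> e != f ->
    (e.1 <= m < e.2)%N -> (f.1 <= m < f.2)%N -> 0 < t < 1 ->
    (1 - t) * height h m e + t * height h m.+1 e = c ->
    (1 - t) * height h m f + t * height h m.+1 f = c ->
    height h m e != height h m f.
  move=> ee ef nef em fm /andP[t0 t1] he hf; apply/eqP => eqm.
  have eqS : height h m.+1 e = height h m.+1 f.
    have : t * height h m.+1 e = t * height h m.+1 f.
      by move: he; rewrite -hf eqm => /addrI.
    by apply: mulfI; rewrite gt_eqF.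
  have [se sSe] := strip_spans em; have [sf sSf] := strip_spans fm.
  have [me mSe] := strip_ends em; have [mf mSf] := strip_ends fm.
  case/andP: em fm => em1 em2 /andP[fm1 fm2].
  have fe := leq_ltn_trans fm1 em2; have fe' := leq_ltn_trans em1 fm2.
  have := tie_ends m e f ee ef nef se sf fe fe' eqm.
  have := tie_ends m.+1 e f ee ef nef sSe sSf fe fe' eqS.
  rewrite me mf mSe mSf => /andP[/eqP h1 /eqP h2] /andP[/eqP h3 /eqP h4].
  by case/eqP: nef; apply: edge_eq; rewrite ?h1 ?h3.
have last_free m e f g (t c : R) : is_edge f -> is_edge g -> f != g ->
    (e.1 <= m < e.2)%N -> (f.1 <= m < f.2)%N -> (g.1 <= m < g.2)%N ->
    0 < t < 1 ->
    (1 - t) * height h m e + t * height h m.+1 e = c ->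
    (1 - t) * height h m f + t * height h m.+1 f = c ->
    (1 - t) * height h m g + t * height h m.+1 g = c ->
    ~~ ends_at m.+1 e ->
    ends_at m.+1 f || (code m.+1 f < code m.+1 e)%N ->
    ends_at m.+1 g || (code m.+1 g < code m.+1 e)%N -> False.
  move=> ef eg nfg em fm gm t01 he hf hg free_e lf lg.
  have neq := distinct m f g t c ef eg nfg fm gm t01 hf hg.
  have mn : (m < n)%N by case/andP: em => _ /ltn_trans; apply.
  have [_ /negP] := hP (code m.+1 e); apply.
  apply/mapP; exists (Ordinal mn, e, f, g); first by rewrite mem_enum.
  (* All heights in the formula other than that of [e] on line [m.+1] are pinned or chosen earlier,
     so truncating the sequence does not change them. *)
  have trunc k x : (k == m) || ends_at k x || (code k x < code m.+1 e)%N ->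
      height (fun j => if (j < code m.+1 e)%N then h j else 0) k x =
      height h k x.
    rewrite /height; case: (ends_at k x) => //=; rewrite orbF.
    by case/orP => [/eqP ->|->] //; rewrite code_lt.
  rewrite /= !trunc ?eqxx ?lf ?lg //; try by rewrite -orbA ?lf ?lg orbT.
  have <- : height h m.+1 e = h (code m.+1 e) by rewrite /height (negbTE free_e).
  move: (height h m e) (height h m.+1 e) (height h m f) (height h m.+1 f)
    (height h m g) (height h m.+1 g) neq he hf hg => E E' F F' G G' neq he hf hg.
  have t0 : t != 0 by case/andP: t01 => t0 _; rewrite gt_eqF.
  (* Eliminating [t] from the three equations leaves a relation that is solved for [E'] since
     [G - F] is nonzero. *)
  have key : (E' - F') * (G - F) = (E - F) * (G' - F').
    apply: (mulfI t0); rewrite mulrA mulrCA.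
    have -> : t * (E' - F') = (1 - t) * (F - E) by lra.
    have -> : t * (G' - F') = (1 - t) * (F - G) by lra.
    by ring.
  by rewrite mulrAC -key mulfK ?subr_eq0 1?eq_sym // addrC subrK.
(* Time at which the height on line [m.+1] is fixed: 0 for pinned heights, and the successor puts
   every free height after them. *)
pose key m x := if ends_at m.+1 x then 0%N else (code m.+1 x).+1.
have largest m e f g (t c : R) : is_edge e -> is_edge f -> is_edge g ->
    e != f -> e != g -> f != g ->
    (e.1 <= m < e.2)%N -> (f.1 <= m < f.2)%N -> (g.1 <= m < g.2)%N ->
    0 < t < 1 ->
    (1 - t) * height h m e + t * height h m.+1 e = c ->
    (1 - t) * height h m f + t * height h m.+1 f = c ->
    (1 - t) * height h m g + t * height h m.+1 g = c ->
    (key m f <= key m e)%N -> (key m g <= key m e)%N -> False.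
  move=> ee ef eg nef neg nfg em fm gm t01 he hf hg kf kg.
  (* Were the latest height pinned, that of [f] would be pinned to 0 as well, and the two segments
     would also agree on line [m]. *)
  have free_e : ~~ ends_at m.+1 e.
    apply/negP => end_e; have /eqP := distinct _ _ _ _ _ ee ef nef em fm t01 he hf.
    have end_f : ends_at m.+1 f.
      by move: kf; rewrite /key end_e; case: (ends_at m.+1 f).
    apply; move: he; rewrite -hf /height end_e end_f !mulr0 !addr0.
    by apply: mulfI; case/andP: t01 => _ t1; rewrite subr_eq0 gt_eqF.
  have below x : e != x -> (key m x <= key m e)%N ->
      ends_at m.+1 x || (code m.+1 x < code m.+1 e)%N.
    rewrite /key (negbTE free_e); case: (ends_at m.+1 x) => //= nex.
    rewrite ltnS leq_eqVlt => /predU1P[/code_inj[_ ex]|//].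
    by rewrite ex eqxx in nex.
  exact: (last_free m e f g t c ef eg nfg em fm gm t01 he hf hg free_e
    (below f nef kf) (below g neg kg)).
move=> m e f g t c ee ef eg nef neg nfg em fm gm t01 he hf hg.
have [nfe nge ngf] : [/\ f != e, g != e & g != f] by split; rewrite eq_sym.
have [h1|/ltnW h1] := leqP (key m e) (key m f);
  have [h2|/ltnW h2] := leqP (key m f) (key m g).
- by apply: (largest m g e f t c) => //; exact: leq_trans h2.
- exact: (largest m f e g t c).
- have [h3|/ltnW h3] := leqP (key m e) (key m g).
    exact: (largest m g e f t c).
  exact: (largest m e f g t c).
- by apply: (largest m e f g t c) => //; exact: leq_trans h1.
Qed.
End Heights.

(** * Tent functions and proper crossings of lines *)

Local Open Scope classical_set_scope.
Local Open Scope ring_scope.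

(** The tent function with peak 1 at 0 and support [-1, 1]; absolute values make its continuity
    immediate. *)
Definition hat (R : realType) (t : R) : R :=
  (`|t + 1| + `|t - 1|) / 2 - `|t|.

Lemma hat_out (R : realType) (t : R) : 1 <= `|t| -> hat t = 0.
Proof.
rewrite /hat; case: (ger0P t) => t0 t1.
  by rewrite ger0_norm ?[`|t - 1|]ger0_norm; lra.
by rewrite [`|t + 1|]ler0_norm ?ler0_norm; lra.
Qed.

Lemma hat_in (R : realType) (t : R) : `|t| <= 1 -> hat t = 1 - `|t|.
Proof.
rewrite /hat ler_norml => /andP[? ?].
by rewrite [`|t + 1|]ger0_norm ?[`|t - 1|]ler0_norm; lra.
Qed.

Lemma hat_continuous (R : realType) : continuous (@hat R).
Proof.
move=> t; apply: cvgB; last exact: norm_continuous.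
apply: cvgM; last exact: cvg_cst.
by apply: cvgD; apply: cvg_norm; [apply: cvgD|apply: cvgB];
  [exact: cvg_id|exact: cvg_cst|exact: cvg_id|exact: cvg_cst].
Qed.

Lemma pair_continuous (T U V : topologicalType) (f : T -> U) (g : T -> V) :
  continuous f -> continuous g -> continuous (fun x => (f x, g x)).
Proof. by move=> fc gc x; apply: cvg_pair; [exact: fc|exact: gc]. Qed.

(* Shearing the strip by the two affine functions straightens both graphs. *)
Lemma affine_graphs_cross (R : realType) (A B : set (R * R))
    (lo hi a b c d : R) (p : R * R) : a != c -> lo < p.1 < hi ->
  (forall z, lo < z.1 < hi ->
     (A z <-> z.2 = a * z.1 + b) /\ (B z <-> z.2 = c * z.1 + d)) ->
  A p -> B p -> properly_cross_at A B p.
Proof.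
move=> ac hp AB Ap Bp.
have ac0 : a - c != 0 by rewrite subr_eq0.
have [pa pc] : p.2 = a * p.1 + b /\ p.2 = c * p.1 + d.
  by have [[h1 _] [h2 _]] := AB p hp; split; [exact: h1|exact: h2].
pose h (z : R * R) := (z.2 - c * z.1 - d, z.2 - a * z.1 - b).
pose kx (w : R * R) := (w.1 - w.2 + d - b) / (a - c).
pose k (w : R * R) := (kx w, w.2 + a * kx w + b).
have hk z : k (h z) = z.
  have kxh : kx (h z) = z.1.
    rewrite /kx /h /=; apply: (mulIf ac0); rewrite mulfVK //; ring.
  by rewrite /k kxh /h /= [RHS]surjective_pairing; congr (_, _); ring.
have kh w : h (k w) = w.
  have kxE : (a - c) * kx w = w.1 - w.2 + d - b by rewrite /kx mulrC mulfVK.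
  rewrite [RHS]surjective_pairing /h /k /=; congr (_, _); last by ring.
  by move: kxE; rewrite mulrBl; lra.
have kx_cont : continuous kx.
  move=> w; apply: cvgM; last exact: cvg_cst.
  apply: cvgB; last exact: cvg_cst.
  apply: cvgD; last exact: cvg_cst.
  by apply: cvgB; [exact: cvg_fst|exact: cvg_snd].
have strip_open (f : R * R -> R) : continuous f ->
    open [set z | lo < f z < hi].
  move=> fc.
  rewrite (_ : [set z | _] =
    (f @^-1` [set x | x > lo]) `&` (f @^-1` [set x | x < hi])).
    by apply: openI; apply: open_comp.
  by apply/seteqP; split=> z /=; [move/andP|move=> [-> ->]].
exists [set z | lo < z.1 < hi], [set w | lo < kx w < hi], h, k.
split; [split|split; [split|]].
- by apply: strip_open => z; exact: cvg_fst.
- exact: strip_open.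
- exact: hp.
- by rewrite /h {1}pc pa; congr (_, _); ring.
- apply: continuous_subspaceT; apply: pair_continuous => z.
    apply: cvgB; last exact: cvg_cst.
    apply: cvgB; first exact: cvg_snd.
    by apply: cvgM; [exact: cvg_cst|exact: cvg_fst].
  apply: cvgB; last exact: cvg_cst.
  apply: cvgB; first exact: cvg_snd.
  by apply: cvgM; [exact: cvg_cst|exact: cvg_fst].
- apply: continuous_subspaceT; apply: pair_continuous => // w.
  apply: cvgD; last exact: cvg_cst.
  apply: cvgD; first exact: cvg_snd.
  by apply: cvgM; [exact: cvg_cst|exact: kx_cont].
- move=> z /= hz; split; last exact: hk.
  by rewrite -[kx _]/((k (h z)).1) hk.
- by move=> w /= hw; split=> //; exact: kh.
move=> z /= /AB[Az Bz]; split.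
  by split=> [/Az ->|h0]; [ring|apply/Az; lra].
by split=> [/Bz ->|h0]; [ring|apply/Bz; lra].
Qed.

(** * Polygonal curves through prescribed heights *)

Section Curves.
Variables (R : realType) (n : nat) (H : nat -> 'I_n * 'I_n -> R).
Implicit Types e f g : 'I_n * 'I_n.

(** A combination of tents is linear between consecutive integers and takes the value [H m e] at
    [m]. *)
Definition curve e (x : R) : R := \sum_(m < n) H m e * hat (x - m%:R).

Lemma curve_continuous e : continuous (curve e).
Proof.
move=> x; apply: cvg_big => [|i _]; first exact: add_continuous.
apply: cvgM; first exact: cvg_cst.
apply: (@continuous_comp _ _ _ (fun y : R => y - i%:R) (@hat R)).
  by apply: cvgB; [exact: cvg_id|exact: cvg_cst].
exact: hat_continuous.
Qed.

Lemma curve_strip m e x : (m.+1 < n)%N -> m%:R <= x <= m.+1%:R ->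
  curve e x = (1 - (x - m%:R)) * H m e + (x - m%:R) * H m.+1 e.
Proof.
move=> mn /andP[x1 x2]; have mn' := ltnW mn.
have x2' : x <= m%:R + 1 by rewrite -natr1 in x2.
rewrite /curve (bigD1 (Ordinal mn')) //= (bigD1 (Ordinal mn)) /=; last first.
  by rewrite -val_eqE /= gtn_eqF.
rewrite big1 ?addr0 => [|i]; last first.
  rewrite -!val_eqE /= => /andP[im im1].
  rewrite hat_out ?mulr0 //.
  case: (ltngtP i m) im => // im _.
    have : (i.+1)%:R <= m%:R :> R by rewrite ler_nat.
    by rewrite -natr1 => h; rewrite ger0_norm; lra.
  have {}im1 : (m.+2 <= i)%N by rewrite ltn_neqAle eq_sym im1.
  have : (m.+2)%:R <= i%:R :> R by rewrite ler_nat.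
  by rewrite -!natr1 => h; rewrite ler0_norm; lra.
rewrite !hat_in -?natr1; last 2 first.
- by rewrite ler0_norm; lra.
- by rewrite ger0_norm; lra.
by rewrite ger0_norm ?ler0_norm; [ring|lra|lra].
Qed.

Lemma curve_nat m e : (m < n)%N -> curve e m%:R = H m e.
Proof.
move=> mn; rewrite /curve (bigD1 (Ordinal mn)) //= big1 => [|i im].
  by rewrite subrr hat_in normr0 // subr0 mulr1 addr0.
rewrite hat_out ?mulr0 //; move: im; rewrite -val_eqE /=.
case: (ltngtP i m) => // im _.
  have : (i.+1)%:R <= m%:R :> R by rewrite ler_nat.
  by rewrite -natr1 => h; rewrite ger0_norm; lra.
have : (m.+1)%:R <= i%:R :> R by rewrite ler_nat.
by rewrite -natr1 => h; rewrite ler0_norm; lra.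
Qed.

Lemma strip_exists (a b : nat) (x : R) : (a < b)%N -> a%:R <= x <= b%:R ->
  exists2 m, (a <= m < b)%N & m%:R <= x <= m.+1%:R.
Proof.
elim: b => // b IH; rewrite ltnS leq_eqVlt => /predU1P[->|ab] /andP[ax xb].
  by exists b; rewrite ?leqnn ?ltnSn ?ax.
have [xb'|/ltW xb'] := leP x b%:R.
  have [|m /andP[am mb] hx] := IH ab; first by rewrite ax.
  by exists m => //; rewrite am ltnW.
by exists b; rewrite ?xb' // ltnW //= ltnSn.
Qed.
End Curves.

Lemma inner_line n (m : nat) (e : 'I_n * 'I_n) :
  (e.1 < m < e.2)%N -> spans m e /\ ~~ ends_at m e.
Proof. by rewrite /spans /ends_at; lia. Qed.

(** * The polygonal drawing and its properties *)

Section Drawing.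
Variables (R : realType) (n : nat) (tau : nat -> nat -> nat -> bool).
Variable H : nat -> 'I_n * 'I_n -> R.
Implicit Types e f g : 'I_n * 'I_n.
Local Notation level := (level R tau).

Hypothesis tauL : forall a b c d, (a < b)%N -> (b < c)%N -> (c < d)%N ->
  (d < n)%N -> tau a b c = tau a c d -> tau a b d = tau a b c.
Hypothesis tauR : forall a b c d, (a < b)%N -> (b < c)%N -> (c < d)%N ->
  (d < n)%N -> tau a b d = tau b c d -> tau a c d = tau a b d.
Hypothesis H_ends : forall m e, ends_at m e -> H m e = 0.
Hypothesis H_sign : forall m e, (e.1 < m < e.2)%N ->
  if tau e.1 m e.2 then 0 < H m e else H m e < 0.
Hypothesis H_mono : forall m e f, is_edge e -> is_edge f ->
  spans m e -> spans m f -> ~~ (ends_at m e && ends_at m f) ->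
  level m e < level m f -> H m e < H m f.
Hypothesis H_generic : forall m e f g (t c : R),
  is_edge e -> is_edge f -> is_edge g -> e != f -> e != g -> f != g ->
  (e.1 <= m < e.2)%N -> (f.1 <= m < f.2)%N -> (g.1 <= m < g.2)%N ->
  0 < t < 1 ->
  (1 - t) * H m e + t * H m.+1 e = c ->
  (1 - t) * H m f + t * H m.+1 f = c ->
  (1 - t) * H m g + t * H m.+1 g = c -> False.

Definition curve_drawing : pre_drawing R n :=
  PreDrawing (fun i : 'I_n => ((i : nat)%:R, 0))
    (fun e => [set p | (e.1 : nat)%:R <= p.1 <= (e.2 : nat)%:R /\
                       p.2 = curve H e p.1]).
Local Notation D := curve_drawing.

Lemma H_neq m e f : is_edge e -> is_edge f -> e != f ->
  spans m e -> spans m f -> ~~ (ends_at m e && ends_at m f) ->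
  H m e != H m f.
Proof.
move=> ee ef nef se sf nends.
have [|fe] := leqP e.2 f.1.
  by move: se sf nends; rewrite /spans /ends_at; lia.
have [|ef'] := leqP f.2 e.1.
  by move: se sf nends; rewrite /spans /ends_at; lia.
have := level_neq R tauL ee ef nef se sf fe ef'.
by rewrite !neq_lt => /orP[] /H_mono ->; rewrite ?orbT // andbC.
Qed.

Lemma strip_neq m e f : is_edge e -> is_edge f -> e != f ->
  (e.1 <= m < e.2)%N -> (f.1 <= m < f.2)%N ->
  H m e = H m f -> H m.+1 e != H m.+1 f.
Proof.
move=> ee ef nef em fm.
have [se sSe] := strip_spans em; have [sf sSf] := strip_spans fm.
have [me mSe] := strip_ends em; have [mf mSf] := strip_ends fm.
move=> h0; apply/eqP => hS.
have : ends_at m e && ends_at m f.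
  by apply/negPn/negP => /(H_neq ee ef nef se sf); rewrite h0 eqxx.
have : ends_at m.+1 e && ends_at m.+1 f.
  by apply/negPn/negP => /(H_neq ee ef nef sSe sSf); rewrite hS eqxx.
rewrite me mf mSe mSf => /andP[/eqP e2 /eqP f2] /andP[/eqP e1 /eqP f1].
by case/eqP: nef; apply: edge_eq; rewrite ?e1 ?e2.
Qed.

(** If the levels had the same order on both boundary lines, the heights would be weakly ordered on
    both and strictly on at least one, so the segments could not meet inside. *)
Lemma strip_reversal m e f (t : R) : is_edge e -> is_edge f -> e != f ->
  (e.1 <= m < e.2)%N -> (f.1 <= m < f.2)%N -> 0 < t < 1 ->
  (1 - t) * H m e + t * H m.+1 e = (1 - t) * H m f + t * H m.+1 f ->
  level m e < level m f /\ level m.+1 f < level m.+1 e \/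
  level m f < level m e /\ level m.+1 e < level m.+1 f.
Proof.
move=> ee ef nef em fm t01 eq_t.
have [se sSe] := strip_spans em; have [sf sSf] := strip_spans fm.
have fe : (f.1 < e.2)%N.
  by case/andP: em fm => _ h2 /andP[h3 _]; apply: leq_ltn_trans h2.
have ef' : (e.1 < f.2)%N.
  by case/andP: fm em => _ h2 /andP[h3 _]; apply: leq_ltn_trans h2.
(* Only weakly: at a common end both heights are 0 although the levels differ. *)
have weak k x y : is_edge x -> is_edge y -> spans k x -> spans k y ->
    level k x < level k y -> H k x <= H k y.
  move=> ex ey sx sy lxy.
  have [/andP[hx hy]|h] := boolP (ends_at k x && ends_at k y).
    by rewrite !H_ends.
  by apply: ltW; apply: H_mono.
have no x y : is_edge x -> is_edge y -> x != y ->
    (x.1 <= m < x.2)%N -> (y.1 <= m < y.2)%N ->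
    spans m x -> spans m y -> spans m.+1 x -> spans m.+1 y ->
    (1 - t) * H m x + t * H m.+1 x = (1 - t) * H m y + t * H m.+1 y ->
    level m x < level m y -> level m.+1 x < level m.+1 y -> False.
  move=> ex ey nxy xm ym sx sy sSx sSy eq_xy l0 l1.
  have h0 := weak _ _ _ ex ey sx sy l0; have h1 := weak _ _ _ ex ey sSx sSy l1.
  have := strip_neq ex ey nxy xm ym; case/andP: t01 => t0 t1.
  have [h0e /(_ h0e)|h0n _] := eqVneq (H m x) (H m y).
    move=> h1n; have : t * H m.+1 x < t * H m.+1 y.
      by rewrite ltr_pM2l // lt_neqAle h1n.
    by move: eq_xy; rewrite h0e; lra.
  have : (1 - t) * H m x < (1 - t) * H m y.
    by rewrite ltr_pM2l ?subr_gt0 // lt_neqAle h0n.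
  have : t * H m.+1 x <= t * H m.+1 y by rewrite ler_pM2l.
  by move: eq_xy; lra.
have := level_neq R tauL ee ef nef se sf fe ef'.
have := level_neq R tauL ee ef nef sSe sSf fe ef'.
rewrite !neq_lt => /orP[l1|l1] /orP[l0|l0]; [|by right|by left|].
  by case: (no e f).
by case: (no f e) => //; rewrite eq_sym.
Qed.

Lemma interior_x e p : is_edge e -> edge_interior D e p ->
  (e.1 : nat)%:R < p.1 < (e.2 : nat)%:R.
Proof.
move=> ee [[/andP[p1 p2] py] n1 n2].
have end_val (i : 'I_n) :
    ends_at i e -> p.1 = (i : nat)%:R -> p = ((i : nat)%:R, 0).
  move=> hi px; rewrite [LHS]surjective_pairing py px.
  by rewrite curve_nat // H_ends.
rewrite !lt_neqAle p1 p2 !andbT; apply/andP; split; apply/eqP => px.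
  by apply: n1; apply: end_val => //; rewrite /ends_at eqxx.
by apply: n2; apply: end_val => //; rewrite /ends_at eqxx orbT.
Qed.

(** On a line through a vertex strictly inside both edges the heights differ, so a common interior
    point lies strictly between two consecutive lines. *)
Lemma common_point_strip e f p : is_edge e -> is_edge f -> e != f ->
  edge_interior D e p -> edge_interior D f p ->
  exists m, [/\ (e.1 <= m < e.2)%N, (f.1 <= m < f.2)%N & 0 < p.1 - m%:R < 1].
Proof.
move=> ee ef nef pe pf.
have /andP[e1 e2] := interior_x ee pe; have /andP[f1 f2] := interior_x ef pf.
have [[_ ye] _ _] := pe; have [[_ yf] _ _] := pf.
have [|m em /andP[m1 m2]] := @strip_exists R e.1 e.2 p.1 ee; first by rewrite !ltW.
have not_nat k : (k < n)%N -> p.1 != k%:R.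
  move=> kn; apply/eqP => pk.
  move: e1 e2 f1 f2; rewrite pk !ltr_nat => e1 e2 f1 f2.
  have [se nends] := inner_line (introT andP (conj e1 e2)).
  have [sf _] := inner_line (introT andP (conj f1 f2)).
  have := H_neq ee ef nef se sf; rewrite (negbTE nends) => /(_ isT).
  by rewrite -!(curve_nat H) // -pk -ye yf eqxx.
have mn : (m.+1 < n)%N by case/andP: em => _ /leq_ltn_trans; apply.
have {}m1 : m%:R < p.1 by rewrite lt_neqAle eq_sym not_nat // ltnW.
have {}m2 : p.1 < m.+1%:R by rewrite lt_neqAle not_nat.
exists m; split=> //.
  have := lt_trans f1 m2; have := lt_trans m1 f2.
  by rewrite !ltr_nat ltnS => -> ->.
by move: m2; rewrite -natr1 => m2; apply/andP; split; lra.
Qed.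

Lemma arc_strip e m x : (e.1 <= m < e.2)%N -> 0 <= x - m%:R <= 1 ->
  curve H e x = (1 - (x - m%:R)) * H m e + (x - m%:R) * H m.+1 e.
Proof.
move=> /andP[em me] /andP[x0 x1]; apply: curve_strip.
  by rewrite (leq_ltn_trans me).
by rewrite -natr1; apply/andP; split; lra.
Qed.

Lemma common_reversal e f p : is_edge e -> is_edge f -> e != f ->
  edge_interior D e p -> edge_interior D f p ->
  exists m, [/\ (e.1 <= m < e.2)%N, (f.1 <= m < f.2)%N, 0 < p.1 - m%:R < 1 &
  level m e < level m f /\ level m.+1 f < level m.+1 e \/
  level m f < level m e /\ level m.+1 e < level m.+1 f].
Proof.
move=> ee ef nef pe pf; have [m [em fm t01]] := common_point_strip ee ef nef pe pf.
exists m; split=> //; apply: (strip_reversal ee ef nef em fm t01).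
have [[_ ye] _ _] := pe; have [[_ yf] _ _] := pf.
have /andP[/ltW t0 /ltW t1] := t01.
by rewrite -!arc_strip ?t0 // -ye.
Qed.

Lemma strip_unique e f m x y : is_edge e -> is_edge f -> e != f ->
  (e.1 <= m < e.2)%N -> (f.1 <= m < f.2)%N ->
  0 <= x - m%:R <= 1 -> 0 <= y - m%:R <= 1 ->
  curve H e x = curve H f x -> curve H e y = curve H f y -> x = y.
Proof.
move=> ee ef nef em fm hx hy; rewrite !(arc_strip _ hx) // !(arc_strip _ hy) //.
have := strip_neq ee ef nef em fm.
move: (H m e) (H m f) (H m.+1 e) (H m.+1 f) => A B A' B' nAB eqx eqy.
(* The difference of the two curves is affine on the strip; vanishing at [x] and [y] it has slope 0
   or [x = y]. *)
have h : (x - y) * ((A' - B') - (A - B)) = 0.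
  by move: eqx eqy; rewrite !mulrBl !mulrBr; lra.
move/eqP: h; rewrite mulf_eq0 !subr_eq0 => /orP[/eqP //|/eqP d].
have AB : A = B.
  have : A - B = (1 - (x - m%:R)) * (A - B) + (x - m%:R) * (A' - B').
    by rewrite d; ring.
  by move: eqx; rewrite !mulrBr; lra.
by have := nAB AB; rewrite -subr_eq0 d AB subrr eqxx.
Qed.

Lemma curve_drawing_arc e : is_edge e ->
  is_arc (arc D e) (vertex D e.1) (vertex D e.2).
Proof.
move=> ee; pose a : R := (e.1 : nat)%:R; pose b : R := (e.2 : nat)%:R.
have ab : 0 < b - a by rewrite subr_gt0 ltr_nat.
have gc : continuous (fun t : R => a + t * (b - a)).
  move=> t; apply: cvgD; first exact: cvg_cst.
  by apply: cvgM; [exact: cvg_id|exact: cvg_cst].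
exists (fun t => (a + t * (b - a), curve H e (a + t * (b - a)))); split.
- apply: continuous_subspaceT; apply: pair_continuous => // t.
  apply: (@continuous_comp _ _ _ (fun t : R => a + t * (b - a))); first exact: gc.
  exact: curve_continuous.
- move=> s t _ _ [/addrI/mulIf st _]; apply: st; exact: lt0r_neq0.
- rewrite mul0r addr0 curve_nat // H_ends // /ends_at eqxx //.
- by rewrite mul1r subrKC curve_nat // H_ends // /ends_at eqxx orbT.
apply/seteqP; split=> [[x y] /= [/andP[ax xb] ->]|_ [t /andP[t0 t1] <-]] /=.
  exists ((x - a) / (b - a)).
    apply/andP; split; last by rewrite ler_pdivrMr // mul1r lerB.
    by apply: divr_ge0; [rewrite subr_ge0|exact: ltW].
  by rewrite mulfVK ?gt_eqF // subrKC.
split=> //; rewrite -/a -/b; apply/andP; split.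
  by rewrite lerDl mulr_ge0 // ltW.
by rewrite -lerBrDl ler_piMl // ltW.
Qed.

(** Each strip spanned by both edges contains at most one common point; any other common point is an
    end of [f]. *)
Lemma curve_drawing_finite e f : is_edge e -> is_edge f -> e != f ->
  finite_set (arc D e `&` arc D f).
Proof.
move=> ee ef nef.
pose S (m : nat) : set (R * R) := [set p | [/\ arc D e p, arc D f p,
  (e.1 <= m < e.2)%N /\ (f.1 <= m < f.2)%N & 0 <= p.1 - m%:R <= 1]].
have S_finite m : finite_set (S m).
  have [[p0 Sp0]|noS] := pselect (exists p, S m p); last first.
    rewrite (_ : S m = set0); first exact: finite_set0.
    by apply/seteqP; split=> // p Sp; case: noS; exists p.
  apply: (@sub_finite_set _ _ [set p0]) => // p [pe pf [em fm] hp].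
  have [pe0 pf0 _ hp0] := Sp0.
  have px : p.1 = p0.1.
    apply: (strip_unique ee ef nef em fm hp hp0).
      by rewrite -(proj2 pe) -(proj2 pf).
    by rewrite -(proj2 pe0) -(proj2 pf0).
  by rewrite /= (surjective_pairing p) (surjective_pairing p0) px
    (proj2 pe) (proj2 pe0) px.
apply: (@sub_finite_set _ _ (\bigcup_(m in `I_n) S m `|`
    [set vertex D f.1; vertex D f.2])); last first.
  rewrite finite_setU; split; last exact: finite_set2.
  by apply: bigcup_finite => // *; exact: finite_II.
move=> p [pe pf]; have [/andP[e1 e2] _] := pe; have [/andP[f1 f2] yf] := pf.
have f_end (i : 'I_n) : ends_at i f -> p.1 = (i : nat)%:R -> p = vertex D i.
  move=> hi px; rewrite [LHS]surjective_pairing yf px.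
  by rewrite curve_nat // H_ends.
have [|m em /andP[m1 m2]] := @strip_exists R e.1 e.2 p.1 ee; first by rewrite e1.
have [fm|fm] := boolP (f.1 <= m < f.2)%N.
  left; exists m; first by case/andP: em => _ /ltn_trans; apply.
  by split=> //; move: m2; rewrite -natr1 => m2; apply/andP; split; lra.
right; move: fm; rewrite negb_and -ltnNge -leqNgt => /orP[fm|fm].
  left; apply: f_end; first by rewrite /ends_at eqxx.
  by apply/eqP; rewrite eq_le f1 (le_trans m2) // ler_nat.
right; apply: f_end; first by rewrite /ends_at eqxx orbT.
by apply/eqP; rewrite eq_le f2 (le_trans _ m1) // ler_nat.
Qed.

Lemma curve_drawing_cross e f p : is_edge e -> is_edge f -> e != f ->
  edge_interior D e p -> edge_interior D f p ->
  properly_cross_at (arc D e) (arc D f) p.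
Proof.
move=> ee ef nef pe pf.
have [m [em fm t01]] := common_point_strip ee ef nef pe pf.
have arc_line x z : is_edge x -> (x.1 <= m < x.2)%N ->
    m%:R < z.1 < m.+1%:R -> arc D x z <->
    z.2 = (H m.+1 x - H m x) * z.1 + (H m x - m%:R * (H m.+1 x - H m x)).
  move=> ex xm /andP[z1 z2].
  have -> : (H m.+1 x - H m x) * z.1 + (H m x - m%:R * (H m.+1 x - H m x)) =
      curve H x z.1.
    rewrite (arc_strip xm); first by ring.
    by move: z2; rewrite -natr1 => z2; apply/andP; split; lra.
  split=> [[]//|zy]; split=> //; case/andP: xm => xm mx.
  rewrite (le_trans _ (ltW z1)) ?ler_nat //.
  by rewrite (le_trans (ltW z2)) // ler_nat.
have strip_p : m%:R < p.1 < m.+1%:R by rewrite -natr1; move: t01; lra.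
apply: (@affine_graphs_cross _ _ _ m%:R m.+1%:R (H m.+1 e - H m e)
  (H m e - m%:R * (H m.+1 e - H m e)) (H m.+1 f - H m f)
  (H m f - m%:R * (H m.+1 f - H m f))) => //.
(* Lines of equal slope through a common point coincide, so the heights would agree on both boundary
   lines. *)
- apply/eqP => slope.
  have [ae _ _] := pe; have [af _ _] := pf.
  have := proj1 (arc_line e p ee em strip_p) ae.
  rewrite (proj1 (arc_line f p ef fm strip_p) af) slope => /addrI eqH.
  have h0 : H m e = H m f by move/addIr: eqH.
  have := strip_neq ee ef nef em fm h0.
  by move: slope; rewrite h0 => /addIr ->; rewrite eqxx.
- by move=> z hz; split; exact: arc_line.
- by case: pe.
- by case: pf.
Qed.

Lemma curve_drawing_no_triple e f g p :
  is_edge e -> is_edge f -> is_edge g -> e != f -> e != g -> f != g ->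
  ~ [/\ edge_interior D e p, edge_interior D f p & edge_interior D g p].
Proof.
move=> ee ef eg nef neg nfg [pe pf pg].
have [m [em fm t01]] := common_point_strip ee ef nef pe pf.
have gm : (g.1 <= m < g.2)%N.
  have /andP[g1 g2] := interior_x eg pg; case/andP: t01 => t0 t1.
  have : (g.1 : nat)%:R < m.+1%:R :> R by rewrite -natr1; lra.
  have : m%:R < (g.2 : nat)%:R :> R by lra.
  by rewrite !ltr_nat ltnS => -> ->.
have t01' : 0 <= p.1 - m%:R <= 1 by case/andP: t01 => /ltW -> /ltW ->.
have [[_ ye] _ _] := pe; have [[_ yf] _ _] := pf; have [[_ yg] _ _] := pg.
apply: (@H_generic m e f g (p.1 - m%:R) p.2) => //.
- by rewrite -arc_strip // -ye.
- by rewrite -arc_strip // -yf.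
- by rewrite -arc_strip // -yg.
Qed.

Lemma curve_drawing_is_drawing : is_drawing D.
Proof.
split; split.
- by move=> i j [] /eqP; rewrite eqr_nat => /eqP/val_inj.
- exact: curve_drawing_arc.
- move=> e i ee [/= /andP[]]; rewrite !ler_nat curve_nat // => ei ie h0.
  rewrite /incident -!val_eqE /=; apply/negPn/negP; rewrite negb_or => /andP[n1 n2].
  have := @H_sign i e; rewrite -h0 !ltn_neqAle ei ie [_ == i :> nat]eq_sym n1 n2.
  by move=> /(_ isT); case: (tau _ _ _); rewrite ltxx.
- exact: curve_drawing_finite.
- by move=> e f p ee ef nef pe pf; split=> //; exact: curve_drawing_cross.
exact: curve_drawing_no_triple.
Qed.

Lemma curve_drawing_x_monotone : x_monotone D.
Proof.
split=> [i j /eqP|e _ p q [_ yp] [_ yq] pq].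
  by rewrite eqr_nat => /eqP/val_inj.
by rewrite (surjective_pairing p) (surjective_pairing q) yp yq pq.
Qed.

Lemma curve_drawing_left_to_right : labelled_left_to_right D.
Proof. by move=> i j; rewrite /= ltr_nat. Qed.

Lemma adjacent_shared e f : adjacent e f ->
  [\/ e.1 = f.1, e.2 = f.2, e.1 = f.2 | e.2 = f.1].
Proof.
by case/andP=> _ /existsP[i /andP[/orP[] /eqP <- /orP[] /eqP ->]];
  [constructor 1|constructor 3|constructor 4|constructor 2].
Qed.

Lemma curve_drawing_semisimple : semisimple D.
Proof.
move=> e f ee ef adj p [pe pf _].
have nef : e != f by case/andP: adj.
have [m [/andP[e1 e2] /andP[f1 f2] _ rev]] := common_reversal ee ef nef pe pf.
(* Edges where one ends at the start of the other span no common strip. *)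
have shared : e.1 = f.1 \/ e.2 = f.2.
  case: (adjacent_shared adj) => h; [by left|by right| |]; exfalso.
    by move: e1; rewrite h leqNgt f2.
  by move: f1; rewrite -h leqNgt e2.
case: rev => -[l0 l1].
  have := adjacent_keep tauL tauR ee ef nef shared e1 f1 e2 f2 l0.
  by rewrite ltNge (ltW l1).
have nfe : f != e by rewrite eq_sym.
have shared' : f.1 = e.1 \/ f.2 = e.2 by case: shared => ->; [left|right].
have := adjacent_keep tauL tauR ef ee nfe shared' f1 e1 f2 e2 l0.
by rewrite ltNge (ltW l1).
Qed.

Lemma curve_drawing_signature (i j k : 'I_n) : (i < j)%N -> (j < k)%N ->
  signature D i j k = tau i j k.
Proof.
move=> ij jk; rewrite /signature.
have /(_ _)/= := @H_sign j (i, k); rewrite ij jk => /(_ isT).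
case: asboolP => [[y [/= [_ ->]]]|nab]; rewrite ?curve_nat //.
  by move=> hy; case: (tau i j k) => //; rewrite ltNge ltW.
case: (tau i j k) => // hneg; case: nab; exists (H j (i, k)); split=> //=.
by rewrite curve_nat // !ler_nat (ltnW ij) (ltnW jk).
Qed.

Hypothesis no_forbidden : forall a b c d z, (a < b)%N -> (b < c)%N ->
  (c < d)%N -> (d < z)%N -> (z < n)%N ->
  ~ [/\ tau a b z = tau a d z, tau a d z = tau b c d &
        tau b c d = ~~ tau a c z].

(** Common points in different strips are two reversals, and the second restores the order undone by
    the first. Within one strip the segments meet at most once. *)
Lemma curve_drawing_simple : simple D.
Proof.
split; first exact: curve_drawing_semisimple.
have sym e f m k : is_edge e -> is_edge f -> (e.1 < f.1)%N || (f.1 < e.1)%N ->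
    (e.1 <= m < e.2)%N -> (f.1 <= m < f.2)%N ->
    (e.1 <= k < e.2)%N -> (f.1 <= k < f.2)%N -> (m < k)%N ->
    level m e < level m f /\ level m.+1 f < level m.+1 e \/
    level m f < level m e /\ level m.+1 e < level m.+1 f ->
    level k e < level k f /\ level k.+1 f < level k.+1 e \/
    level k f < level k e /\ level k.+1 e < level k.+1 f -> False.
  (* Here [x] is the edge that is lower on line [m]. A second reversal has [x] below [y] on one of
     its two boundary lines, which gives the disjunction. *)
  have go (x y : 'I_n * 'I_n) :
      is_edge x -> is_edge y -> (x.1 < y.1)%N || (y.1 < x.1)%N ->
      (x.1 <= m < x.2)%N -> (y.1 <= m < y.2)%N ->
      (k < x.2)%N -> (k < y.2)%N -> (m < k)%N ->
      level m x < level m y -> level m.+1 y < level m.+1 x ->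
      level k x < level k y \/ level k.+1 x < level k.+1 y -> False.
    move=> ex ey nxy /andP[xm _] /andP[ym _] kx ky mk l0 l1 [] l2.
      have mk' : (m.+1 < k)%N.
        rewrite ltn_neqAle mk andbT; apply/eqP => mk'.
        by move: l2; rewrite -mk' ltNge ltW.
      exact: (reversal_unique tauL tauR no_forbidden nxy xm ym mk'
        (ltnW kx) (ltnW ky) l0 l1 l2).
    have mk' : (m.+1 < k.+1)%N by [].
    exact: (reversal_unique tauL tauR no_forbidden nxy xm ym mk' kx ky l0 l1 l2).
  move=> ee ef nef em fm /andP[_ ke] /andP[_ kf] mk [] [l0 l1] rev.
    by apply: (go e f) => //; case: rev => -[]; [left|right].
  by apply: (go f e) => //; [rewrite orbC|case: rev => -[]; [right|left]].
move=> e f ee ef nef p q [pe pf _] [qe qf _].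
have [m [em fm tp revp]] := common_reversal ee ef nef pe pf.
have [k [ek fk tq revq]] := common_reversal ee ef nef qe qf.
have [[_ ye] _ _] := pe; have [[_ yf] _ _] := pf.
have [[_ ze] _ _] := qe; have [[_ zf] _ _] := qf.
have [adj|nadj] := boolP (adjacent e f).
  exfalso; apply: (curve_drawing_semisimple ee ef adj (p := p)).
  by split=> //; exact: curve_drawing_cross.
have nef1 : (e.1 < f.1)%N || (f.1 < e.1)%N.
  case: ltngtP => // /val_inj h; case/negP: nadj; rewrite /adjacent nef /=.
  by apply/existsP; exists e.1; rewrite /incident h !eqxx.
case: (ltngtP m k) => mk.
- by case: (sym e f m k).
- by case: (sym e f k m).
subst k; have px : p.1 = q.1.
  apply: (strip_unique ee ef nef em fm).
  - by case/andP: tp => /ltW -> /ltW ->.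
  - by case/andP: tq => /ltW -> /ltW ->.
  - by rewrite -ye.
  - by rewrite -ze.
by rewrite (surjective_pairing p) (surjective_pairing q) ye ze px.
Qed.
End Drawing.

(** * Monotone arcs as graphs, and necessity of the 4-tuple condition *)

Lemma within_comp (T U V : topologicalType) (A : set T) (B : set U)
    (f : T -> U) (g : U -> V) :
  {within A, continuous f} -> {within B, continuous g} ->
  (forall x, A x -> B (f x)) -> {within A, continuous (g \o f)}.
Proof.
move=> /subspace_continuousP fc /subspace_continuousP gc AB.
apply/subspace_continuousP => x Ax.
apply: (cvg_comp _ _ _ (gc (f x) (AB x Ax))) => P hP.
have : nbhs x [set y | A y -> B (f y) -> P (f y)] := fc x Ax _ hP.
by apply: filterS => y hy Ay; exact: hy Ay (AB y Ay).
Qed.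

(** By monotonicity the first coordinate of a parametrization is injective, hence increasing, with a
    continuous inverse; composing the second coordinate with that inverse gives the function. *)
Lemma arc_graph (R : realType) (A : set (R * R)) (p q : R * R) :
  is_arc A p q -> (forall u v, A u -> A v -> u.1 = v.1 -> u = v) ->
  p.1 < q.1 ->
  exists F : R -> R, {within `[p.1, q.1], continuous F} /\
    forall z, p.1 <= z.1 <= q.1 -> A z <-> z.2 = F z.1.
Proof.
move=> [g [gc ginj g0 g1 gA]] mono pq.
have set01 : [set t : R | 0 <= t <= 1] = `[0, 1]%classic.
  by apply/seteqP; split=> t; rewrite /= in_itv.
rewrite set01 in gc ginj gA.
have fst_cont : continuous (fst : R * R -> R) by move=> z; exact: cvg_fst.
have snd_cont : continuous (snd : R * R -> R) by move=> z; exact: cvg_snd.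
pose gx := fst \o g.
have gxc : {within `[0, 1], continuous gx}.
  by apply: within_continuous_comp => // z _; exact: fst_cont.
have Ag t : t \in `[0, 1] -> A (g t) by move=> t01; rewrite gA; exists t.
have gxinj : {in `[0, 1] &, injective gx}.
  move=> s t s01 t01 /(mono _ _ (Ag s s01) (Ag t t01)).
  by apply: ginj; rewrite inE.
have gxle : {in `[0, 1] &, {mono gx : x y / x <= y}}.
  by apply: segment_continuous_inj_le; rewrite // /gx /= g0 g1 ltW.
(* The inverse of [gx], with default 0 off its range. *)
pose gi x := xget 0 [set t | t \in `[0, 1] /\ gx t = x].
have giK : {in `[0, 1], cancel gx gi}.
  move=> t t01; have [] : [set s | s \in `[0, 1] /\ gx s = gx t] (gi (gx t)).
    by apply: xgetPex; exists t.
  by move=> s01 /(gxinj _ _ s01 t01).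
have gic : {within `[p.1, q.1], continuous gi}.
  have := segment_can_le_continuous ler01 gxc giK.
  by rewrite /gx /= g0 g1.
have giP x : p.1 <= x <= q.1 -> gi x \in `[0, 1] /\ gx (gi x) = x.
  move=> /andP[px xq].
  apply: (@xgetPex _ 0 [set t | t \in `[0, 1] /\ gx t = x]).
  have [|t t01 <-] := @IVT R gx 0 1 x ler01 gxc; last by exists t.
  by rewrite /gx /= g0 g1 /Num.min /Num.max pq px.
exists (snd \o g \o gi); split.
  apply: (@within_comp R R R _ `[0, 1]%classic gi (snd \o g)) => //.
    by apply: within_continuous_comp => // z _; exact: snd_cont.
  by move=> x /=; rewrite in_itv /= => /giP[].
move=> z hz; have [z01 gz] := giP _ hz; split=> [Az|z2].
  have zg : z = g (gi z.1) by apply: mono => //; exact: Ag.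
  by rewrite {1}zg.
rewrite (_ : z = g (gi z.1)); first exact: Ag.
by rewrite [LHS]surjective_pairing [RHS]surjective_pairing z2 -[(g _).1]/(gx _) gz.
Qed.

Section Necessity.
Variables (R : realType) (n : nat) (D : pre_drawing R n).
Hypotheses (drawD : is_drawing D) (monoD : x_monotone D)
  (orderD : labelled_left_to_right D) (semiD : semisimple D).
Implicit Types (e f : 'I_n * 'I_n) (i j k : 'I_n).
Local Notation vx i := (vertex D i).1.
Local Notation vy i := (vertex D i).2.

Lemma vx_le i j : (i <= j)%N -> vx i <= vx j.
Proof.
by rewrite leq_eqVlt => /predU1P[/val_inj -> //|/orderD/ltW].
Qed.

Lemma edge_graph e : is_edge e -> exists F : R -> R,
  {within `[vx e.1, vx e.2], continuous F} /\
  forall z, vx e.1 <= z.1 <= vx e.2 -> arc D e z <-> z.2 = F z.1.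
Proof.
move=> ee; have [[_ arcD _] _] := drawD.
by apply: arc_graph; [exact: arcD|exact: (proj2 monoD)|exact: orderD].
Qed.

(** The intermediate value theorem gives a common point strictly between the two lines. It is
    interior to both edges, hence a crossing, and adjacent edges have none. *)
Lemma adjacent_no_swap e f i j (y1 y2 z1 z2 : R) :
  is_edge e -> is_edge f -> adjacent e f -> (i < j)%N ->
  (e.1 <= i)%N -> (f.1 <= i)%N -> (j <= e.2)%N -> (j <= f.2)%N ->
  arc D e (vx i, y1) -> arc D f (vx i, y2) ->
  arc D e (vx j, z1) -> arc D f (vx j, z2) -> y1 < y2 -> z2 < z1 -> False.
Proof.
move=> ee ef adj ij ei fi je jf e1 f1 e2 f2 y12 z21.
have [F [Fc FP]] := edge_graph ee; have [G [Gc GP]] := edge_graph ef.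
have vij : vx i < vx j := orderD ij.
have vei := vx_le ei; have vfi := vx_le fi.
have vje := vx_le je; have vjf := vx_le jf.
have Fi : y1 = F (vx i).
  by apply: (proj1 (FP (vx i, y1) _) e1); rewrite /= vei (le_trans (ltW vij)).
have Gi : y2 = G (vx i).
  by apply: (proj1 (GP (vx i, y2) _) f1); rewrite /= vfi (le_trans (ltW vij)).
have Fj : z1 = F (vx j).
  by apply: (proj1 (FP (vx j, z1) _) e2); rewrite /= vje (le_trans vei) ?ltW.
have Gj : z2 = G (vx j).
  by apply: (proj1 (GP (vx j, z2) _) f2); rewrite /= vjf (le_trans vfi) ?ltW.
have sub (a b : R) : a <= vx i -> vx j <= b ->
    `[vx i, vx j]%classic `<=` `[a, b]%classic.
  move=> ai jb x; rewrite /= !in_itv /= => /andP[ix xj].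
  by rewrite (le_trans ai) // (le_trans xj).
have FGc : {within `[vx i, vx j], continuous (F \- G)}.
  have Fc' := continuous_subspaceW (sub _ _ vei vje) Fc.
  have Gc' := continuous_subspaceW (sub _ _ vfi vjf) Gc.
  by move=> x; apply: cvgB; [exact: Fc'|exact: Gc'].
have [|c] := @IVT R (F \- G) (vx i) (vx j) 0 (ltW vij) FGc.
  rewrite /= -Fi -Gi -Fj -Gj /Num.min /Num.max.
  have -> : y1 - y2 < z1 - z2 by lra.
  by apply/andP; split; lra.
rewrite in_itv /= => /andP[ic cj] /eqP; rewrite subr_eq0 => /eqP FGcc.
have {}ic : vx i < c.
  rewrite lt_neqAle ic andbT; apply/eqP => h.
  by move: FGcc; rewrite -h -Fi -Gi; lra.
have {}cj : c < vx j.
  rewrite lt_neqAle cj andbT; apply/eqP => h.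
  by move: FGcc; rewrite h -Fj -Gj; lra.
have inner (g : 'I_n * 'I_n) : (g.1 <= i)%N -> (j <= g.2)%N -> arc D g (c, F c) ->
    edge_interior D g (c, F c).
  move=> /vx_le gi /vx_le jg hg; split=> // h.
    by move: (le_lt_trans gi ic); rewrite -h ltxx.
  by move: (lt_le_trans cj jg); rewrite -h ltxx.
have intE : edge_interior D e (c, F c).
  apply: inner => //; apply/FP => //=.
  by rewrite (le_trans vei (ltW ic)) (le_trans (ltW cj) vje).
have intF : edge_interior D f (c, F c).
  apply: inner => //; apply/GP => //=.
  by rewrite (le_trans vfi (ltW ic)) (le_trans (ltW cj) vjf).
have nef : e != f by case/andP: adj.
have [_ [_ crossD _]] := drawD.
exact: semiD ee ef adj _ (crossD e f _ ee ef nef intE intF).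
Qed.

(** Plus only says that the vertex is not above the edge; the strict inequality comes from edges
    avoiding vertices other than their ends. *)
Lemma signature_spec i j k : (i < j)%N -> (j < k)%N ->
  exists y, arc D (i, k) (vx j, y) /\
    if signature D i j k then vy j < y else y < vy j.
Proof.
move=> ij jk; have ik : is_edge (i, k) by exact: ltn_trans jk.
have [F [_ FP]] := edge_graph ik.
have arcF : arc D (i, k) (vx j, F (vx j)).
  by apply/FP => //=; rewrite !vx_le // ltnW.
exists (F (vx j)); split=> //; rewrite /signature.
case: asboolP => [[y [arcy yj]]|nab].
  rewrite /Minus; suff -> : F (vx j) = y by [].
  by have := proj2 monoD _ ik _ _ arcF arcy erefl => -[].
rewrite /Plus lt_neqAle; apply/andP; split; last first.
  by rewrite leNgt; apply/negP => h; apply: nab; exists (F (vx j)).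
apply/eqP => h; have [[_ _ thruD] _] := drawD.
have := thruD (i, k) j ik; rewrite [vertex D j]surjective_pairing h.
move=> /(_ arcF); rewrite /incident -!val_eqE /=.
by rewrite gtn_eqF // ltn_eqF.
Qed.

Lemma arc_ends e : is_edge e ->
  arc D e (vx e.1, vy e.1) /\ arc D e (vx e.2, vy e.2).
Proof.
move=> ee; have [[_ arcD _] _] := drawD; have [g [_ _ g0 g1 ->]] := arcD e ee.
rewrite -!surjective_pairing; split; [exists 0|exists 1] => //=;
  by rewrite ?lexx ?ler01.
Qed.

(** The edges [ac] and [ad] are compared on the lines through [b] and [c]: at [b] by their sides of
    that vertex, at [c] by the side on which [ad] passes. A violation would swap them. *)
Lemma signature_left (a b c d : 'I_n) : (a < b)%N -> (b < c)%N -> (c < d)%N ->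
  signature D a b c = signature D a c d ->
  signature D a b d = signature D a b c.
Proof.
move=> ab bc cd; have ac := ltn_trans ab bc; have bd := ltn_trans bc cd.
have ad := ltn_trans ab bd.
have [y1 [arc1 s1]] := signature_spec ab bc.
have [y2 [arc2 s2]] := signature_spec ab bd.
have [y3 [arc3 s3]] := signature_spec ac cd.
have [_ arc4] := @arc_ends (a, c) ac.
have adj : adjacent (a, c) (a, d).
  rewrite /adjacent xpair_eqE eqxx /= -val_eqE ltn_eqF //=.
  by apply/existsP; exists a; rewrite /incident eqxx.
have adj' : adjacent (a, d) (a, c).
  rewrite /adjacent xpair_eqE eqxx /= -val_eqE gtn_eqF //=.
  by apply/existsP; exists a; rewrite /incident eqxx.
have no_swap := adjacent_no_swap (e := (a, c)) (f := (a, d)) ac ad adj bc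
  (ltnW ab) (ltnW ab) (leqnn c) (ltnW cd) arc1 arc2 arc4 arc3.
have no_swap' := adjacent_no_swap (e := (a, d)) (f := (a, c)) ad ac adj' bc
  (ltnW ab) (ltnW ab) (ltnW cd) (leqnn c) arc2 arc1 arc3 arc4.
case: (signature D a b c) s1 => s1; case: (signature D a c d) s3 => // s3 _;
  case: (signature D a b d) s2 => // s2; exfalso.
- exact: no_swap' (lt_trans s2 s1) s3.
- exact: no_swap (lt_trans s1 s2) s3.
Qed.

(** The mirror argument with [ad] and [bd], whose order at [b] is the side of [ad] and at [c]
    follows from their sides of that vertex. *)
Lemma signature_right (a b c d : 'I_n) : (a < b)%N -> (b < c)%N -> (c < d)%N ->
  signature D a b d = signature D b c d ->
  signature D a c d = signature D a b d.
Proof.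
move=> ab bc cd; have ac := ltn_trans ab bc; have bd := ltn_trans bc cd.
have ad := ltn_trans ab bd.
have [y1 [arc1 s1]] := signature_spec ab bd.
have [y2 [arc2 s2]] := signature_spec ac cd.
have [y3 [arc3 s3]] := signature_spec bc cd.
have [arc4 _] := @arc_ends (b, d) bd.
have adj : adjacent (a, d) (b, d).
  rewrite /adjacent xpair_eqE eqxx /= -val_eqE ltn_eqF //=.
  by apply/existsP; exists d; rewrite /incident eqxx !orbT.
have adj' : adjacent (b, d) (a, d).
  rewrite /adjacent xpair_eqE eqxx /= -val_eqE gtn_eqF //=.
  by apply/existsP; exists d; rewrite /incident eqxx !orbT.
have no_swap := adjacent_no_swap (e := (a, d)) (f := (b, d)) ad bd adj bc
  (ltnW ab) (leqnn b) (ltnW cd) (ltnW cd) arc1 arc4 arc2 arc3.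
have no_swap' := adjacent_no_swap (e := (b, d)) (f := (a, d)) bd ad adj' bc
  (leqnn b) (ltnW ab) (ltnW cd) (ltnW cd) arc4 arc1 arc3 arc2.
case: (signature D a b d) s1 => s1; case: (signature D b c d) s3 => // s3 _;
  case: (signature D a c d) s2 => // s2; exfalso.
- exact: no_swap' s1 (lt_trans s2 s3).
- exact: no_swap s1 (lt_trans s3 s2).
Qed.
End Necessity.

(** * The ten forms as two implications, and the equivalence *)

Lemma allowed_formsE (x1 x2 x3 x4 : bool) :
  ((x1, x2, x3, x4) \in allowed_forms) =
  ((x1 == x3) ==> (x2 == x1)) && ((x2 == x4) ==> (x3 == x2)).
Proof. by case: x1; case: x2; case: x3; case: x4. Qed.

Theorem theorem3 (R : realType) (n : nat) (hn : (1 <= n)%N)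
    (sigma : sign_function n) :
  (realized_by_semisimple R sigma <-> four_tuple_condition sigma) /\
  (four_tuple_condition sigma ->
   ~ (exists a b c d e : 'I_n,
        [/\ (a < b)%N, (b < c)%N, (c < d)%N & (d < e)%N] /\
        forbidden_five_tuple sigma a b c d e) ->
   realized_by_simple R sigma).
Proof.
(* Extends [sigma] to natural numbers; indices outside the range are sent to the first vertex. *)
pose tau i j k : bool := sigma (insubd (Ordinal hn) i) (insubd (Ordinal hn) j)
  (insubd (Ordinal hn) k).
have tauE (i j k : 'I_n) : tau i j k = sigma i j k by rewrite /tau !valKd.
have ord_of m : (m < n)%N -> exists i : 'I_n, m = i.
  by move=> mn; exists (Ordinal mn).
(* One drawing serves both claims: it is semisimple in any case, and simple when no forbidden
   5-tuple exists. *)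
have drawing : four_tuple_condition sigma -> exists D : pre_drawing R n,
    [/\ is_drawing D, x_monotone D, labelled_left_to_right D, semisimple D &
        realizes D sigma] /\
    (~ (exists a b c d e : 'I_n,
        [/\ (a < b)%N, (b < c)%N, (c < d)%N & (d < e)%N] /\
        forbidden_five_tuple sigma a b c d e) -> simple D).
  move=> four.
  have form (a b c d : nat) : (a < b)%N -> (b < c)%N -> (c < d)%N ->
      (d < n)%N -> (tau a b c, tau a b d, tau a c d, tau b c d) \in allowed_forms.
    move=> ab bc cd dn.
    have cn := ltn_trans cd dn; have bn := ltn_trans bc cn.
    have an := ltn_trans ab bn; move: an bn cn dn ab bc cd.
    move=> /ord_of[a' ->] /ord_of[b' ->] /ord_of[c' ->] /ord_of[d' ->] ab bc cd.
    by rewrite !tauE; have [xi hxi ->] := four a' b' c' d' ab bc cd.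
  have tauL a b c d : (a < b)%N -> (b < c)%N -> (c < d)%N -> (d < n)%N ->
      tau a b c = tau a c d -> tau a b d = tau a b c.
    move=> ab bc cd dn h; have := form a b c d ab bc cd dn.
    by rewrite allowed_formsE h eqxx /= => /andP[/eqP].
  have tauR a b c d : (a < b)%N -> (b < c)%N -> (c < d)%N -> (d < n)%N ->
      tau a b d = tau b c d -> tau a c d = tau a b d.
    move=> ab bc cd dn h; have := form a b c d ab bc cd dn.
    by rewrite allowed_formsE h eqxx /= => /andP[_ /eqP].
  have [H [H_ends H_sign H_mono H_generic]] := heights_exist R tauL.
  exists (curve_drawing H); split.
    split.
    - exact: curve_drawing_is_drawing tauL H_ends H_sign H_mono H_generic.
    - exact: curve_drawing_x_monotone.
    - exact: curve_drawing_left_to_right.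
    - exact: curve_drawing_semisimple tauL tauR H_ends H_mono.
    move=> i j k ij jk.
    by rewrite (curve_drawing_signature H_sign ij jk) tauE.
  move=> nofive; apply: (curve_drawing_simple tauL tauR H_ends H_mono).
  move=> a b c d z ab bc cd dz zn [h1 h2 h3]; apply: nofive.
  have dn := ltn_trans dz zn; have cn := ltn_trans cd dn.
  have bn := ltn_trans bc cn; have an := ltn_trans ab bn.
  move: an bn cn dn zn.
  move=> /ord_of[a' ea] /ord_of[b' eb] /ord_of[c' ec] /ord_of[d' ed] /ord_of[z' ez].
  rewrite ea eb ec ed ez in ab bc cd dz h1 h2 h3; rewrite !tauE in h1 h2 h3.
  by exists a', b', c', d', z'.
split; last first.
  move=> /drawing[D [[drawD monoD orderD _ realD] simpleD]] nofive.
  by exists D; split=> //; exact: simpleD.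
split=> [[D [drawD monoD orderD semiD realD]] a b c d ab bc cd|].
  exists (sigma a b c, sigma a b d, sigma a c d, sigma b c d) => //.
  have ac := ltn_trans ab bc; have bd := ltn_trans bc cd.
  rewrite !realD // allowed_formsE; apply/andP; split; apply/implyP => /eqP h;
    apply/eqP.
    exact: signature_left h.
  exact: signature_right h.
by move=> /drawing[D [[? ? ? ? ?] _]]; exists D.
Qed.
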